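(* Let $d=2$. Let $\Gamma_C=(\mathcal{S},\mathcal{P},\mathcal{E})$ be a correspondence graph with ground-truth node coordinates $\bar x_1,\dots,\bar x_N\in\mathbb{R}^2$ and local coordinates $x_{k,i}$ related to them by Euclidean transforms $\bar{\mathcal{R}}_i$ via $\bar x_k=\bar{\mathcal{R}}_i(x_{k,i})$, $(k,i)\in\mathcal{E}$. Assume (A1) each patch contains at least $3$ nodes whose coordinates are affinely spanning $\mathbb{R}^2$, and (A2) the configuration $(\bar x_k)_k$ is generic. Then the network is uniquely registrable in $\mathbb{R}^2$ if and only if the body graph $\Gamma_B$ is $3$-connected.
   Context: Euclidean transforms are maps $x\mapsto Qx+t$ with $Q$ orthogonal. The correspondence graph is bipartite on nodes $\mathcal{S}=\{1,\dots,N\}$ and patches $\mathcal{P}=\{P_1,\dots,P_M\}$ (subsets of $\mathcal{S}$), with $(k,i)\in\mathcal{E}$ iff $k\in P_i$. The registration problem REG asks for $(x_k)_k$ and Euclidean transforms $(\mathcal{R}_i)_i$ with $x_k=\mathcal{R}_i(x_{k,i})$ for all $(k,i)\in\mathcal{E}$; the network is uniquely registrable if for any two solutions $(\mathbf{X},\boldsymbol{\mathcal{R}}),(\mathbf{Y},\boldsymbol{\mathcal{T}})$ there is a Euclidean transform $\mathcal{Q}$ with $y_k=\mathcal{Q}(x_k)$ for all $k$ (equivalently, under (A1), $\mathcal{T}_i=\mathcal{Q}\circ\mathcal{R}_i$ for all $i$). The body graph $\Gamma_B$ has vertex set $\mathcal{S}$, with an edge between two nodes iff they lie in a common patch. Generic: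 coordinates satisfy no nontrivial polynomial with rational coefficients. A graph is $k$-connected if it has more than $k$ vertices and remains connected after removing fewer than $k$ vertices.
   Formalization: The formal theorem assumes there are more than 3 nodes (N > 3); for N = 3 with one patch holding all nodes the network is uniquely registrable, but the body graph has only 3 vertices and so is not 3-connected by definition. *)

(* Defs.v *)
From HB Require Import structures.
From mathcomp Require Import all_boot all_order all_algebra.
From mathcomp Require Import reals.
From mathcomp Require Import mpoly.
Set Implicit Arguments. Unset Strict Implicit. Unset Printing Implicit Defensive.
Import Order.TTheory GRing.Theory Num.Theory.
Local Open Scope ring_scope.

Section Reg.
Variable R : realType.

Record euclid := Euclid { eQ : 'M[R]_2; et : 'rV[R]_2 }.

Definition is_euclid (T : euclid) : Prop := (eQ T)^T *m eQ T = 1%:M.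

Definition eapp (T : euclid) (x : 'rV[R]_2) : 'rV[R]_2 := x *m eQ T + et T.

(* Correspondence graph: N nodes, M patches P : 'I_M -> {set 'I_N};
   (k,i) is an edge iff k \in P i.  Local coordinates xloc k i (used for k \in P i). *)
Variables (N M : nat) (P : 'I_M -> {set 'I_N})
          (xloc : 'I_N -> 'I_M -> 'rV[R]_2).

Definition reg_solution (X : 'I_N -> 'rV[R]_2) (T : 'I_M -> euclid) : Prop :=
  (forall i, is_euclid (T i)) /\
  (forall i k, k \in P i -> X k = eapp (T i) (xloc k i)).

Definition uniquely_registrable : Prop :=
  forall X T Y U, reg_solution X T -> reg_solution Y U ->
    exists Q : euclid, is_euclid Q /\ forall k, Y k = eapp Q (X k).

Definition patch_affinely_spanning (i : 'I_M) : Prop :=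
  exists k0 k1 k2, [/\ k0 \in P i, k1 \in P i, k2 \in P i &
    \rank (col_mx (xloc k1 i - xloc k0 i) (xloc k2 i - xloc k0 i)) = 2%N].

Definition body_edge : rel 'I_N :=
  fun u v => (u != v) && [exists i, (u \in P i) && (v \in P i)].

End Reg.

Definition k_connected (n : nat) (e : rel 'I_n) (k : nat) : Prop :=
  (k < n)%N /\
  forall S : {set 'I_n}, (#|S| < k)%N ->
    forall u v, u \notin S -> v \notin S ->
      connect [rel a b | [&& e a b, a \notin S & b \notin S]] u v.

Definition generic (R : realType) (N : nat) (x : 'I_N -> 'rV[R]_2) : Prop :=
  forall p : {mpoly rat[N * 2]}, p != 0 ->
    mmap (ratr : rat -> R)
      (fun j => mxvec (\matrix_(k < N, c < 2) x k 0 c) 0 j) p != 0.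

(* Main.v *)
Require Import Defs.
From HB Require Import structures.
From mathcomp Require Import all_boot all_order all_algebra.
From mathcomp Require Import reals.
From mathcomp Require Import mpoly ring lra zify.
Set Implicit Arguments. Unset Strict Implicit. Unset Printing Implicit Defensive.
Import Order.TTheory GRing.Theory Num.Theory.
Local Open Scope ring_scope.

(** Necessity: if two nodes s1, s2 separate the body graph, reflecting one side in the
    line through s1 and s2 gives a solution that is not congruent to the ground truth.

    Sufficiency: write p for the ground truth and let q have the same distances as p
    along the edges of a 3-connected graph G all of whose edges lie in triangles.  The
    proof that q is congruent to p deletes one vertex at a time.

    - If G - v is infinitesimally rigid at p, then q preserves all distances between
      neighbours of v.  Indeed, the squared lengths of an independent set of edges of
      G - v and of three edges at v satisfy a polynomial relation; by genericity its
      gradient at p is a nonzero stress common to p and q, and its equilibrium at v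
      determines the angles at v.  Hence v can be deleted if its neighbours are joined
      into a clique, and this keeps the graph in the class.

    - Such a vertex v exists.  By Laman's theorem a graph that is not rigid has a cover
      by vertex sets X, pairwise meeting in at most one vertex, such that
      sum (2|X| - 3) < 2|V| - 3.  If G has a 3-separator S, counting in such a cover
      shows that each side together with S is rigid, and one recurses into the other
      side with S made a clique.  If G is 4-connected and G - v is not rigid, counting
      gives at least four edges whose only triangle has apex v.  Deleting the edges of
      such a triangle that lie in no other triangle gives a smaller graph of the class,
      unless the triangle has a vertex z of degree 4 for which G - z is rigid.  In the
      first case one recurses on the number of edges.  The recursion into a side of S
      requires v to lie outside a prescribed triangle K; this is harmless as z
      determines the triangle, so that z is in K for at most three of the four. *)

(** * Rank of linear systems and algebraic dependence *)

Section FamilyRank.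
Variables (F : fieldType) (I J : finType).

Definition family_mx (A : I -> J -> F) : 'M[F]_(#|I|, #|J|) :=
  \matrix_(i, j) A (enum_val i) (enum_val j).

Lemma family_mx_full (A : I -> J -> F) :
  (forall u : J -> F, (forall i, \sum_j A i j * u j = 0) -> forall j, u j = 0) ->
  row_full (family_mx A).
Proof.
move=> inj; rewrite /row_full -mxrank_tr; apply: inj_row_free => v vA0.
apply/rowP => j; rewrite mxE.
rewrite -[j]enum_valK; apply: (inj (fun k => v 0 (enum_rank k))) => i.
have /rowP/(_ (enum_rank i)) := vA0; rewrite !mxE => eq0; rewrite -[RHS]eq0 {eq0}.
rewrite (reindex (@enum_val J J)) /=; last exact/onW_bij/enum_val_bij.
by apply: eq_bigr => k _; rewrite !mxE enum_valK enum_rankK mulrC.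
Qed.

Lemma family_mx_inj (A : I -> J -> F) (u : J -> F) : row_full (family_mx A) ->
  (forall i, \sum_j A i j * u j = 0) -> forall j, u j = 0.
Proof.
rewrite /row_full -mxrank_tr => Afree u0 j.
have : \row_(k < #|J|) u (enum_val k) = 0.
  have Afr : row_free (family_mx A)^T by [].
  apply: (row_free_inj Afr); rewrite /= mul0mx; apply/rowP => i.
  rewrite !mxE -[RHS](u0 (enum_val i)).
  rewrite [RHS](reindex (@enum_val J J)) /=; last exact/onW_bij/enum_val_bij.
  by apply: eq_bigr => k _; rewrite !mxE mulrC.
by move/rowP/(_ (enum_rank j)); rewrite !mxE enum_rankK.
Qed.

End FamilyRank.

(** Injectivity at [h0] gives a maximal square minor that is nonzero at [h0]. The minor is a
    rational polynomial in the coordinates, hence a nonzero polynomial, so it cannot vanish at the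
    generic point [h]. *)
Lemma system_specialization (R : realType) (n : nat) (I J : finType)
    (A : I -> J -> {mpoly rat[n]}) (h0 h : 'I_n -> R) :
  (forall G : {mpoly rat[n]}, G != 0 -> mmap (ratr : rat -> R) h G != 0) ->
  (forall u : J -> R,
     (forall i, \sum_j mmap ratr h0 (A i j) * u j = 0) -> forall j, u j = 0) ->
  forall u : J -> R,
     (forall i, \sum_j mmap ratr h (A i j) * u j = 0) -> forall j, u j = 0.
Proof.
move=> hgen /family_mx_full full0 u.
apply: family_mx_inj; move: (fullrowsub_unit full0).
set f := fullrankfun _; rewrite unitmxE unitfE => det0.
pose M : 'M[{mpoly rat[n]}]_(#|J|) :=
  \matrix_(i, j) A (enum_val (f i)) (enum_val j).
have eqM g : rowsub f (family_mx (fun i j => mmap (ratr : rat -> R) g (A i j)))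
   = map_mx (mmap (ratr : rat -> R) g) M.
  by apply/matrixP => i j; rewrite !mxE.
have detM0 : \det M != 0.
  by apply: contra det0 => /eqP detM0; rewrite eqM det_map_mx detM0 rmorph0.
have : rowsub f (family_mx (fun i j => mmap (ratr : rat -> R) h (A i j)))
  \in unitmx by rewrite eqM unitmxE unitfE det_map_mx hgen.
rewrite -row_full_unit /row_full => /eqP rk.
rewrite eqn_leq rank_leq_col /= -[X in (X <= _)%N]rk mxrankS //.
by apply/row_subP => i; rewrite row_rowsub row_sub.
Qed.

(** The rows of [A] together with the coordinate rows indexed by [D] have full column rank, so the
    rank of [A] is at least the size of the complement of [D]; a basis is then chosen among the rows
    of [A]. *)
Lemma independent_rows (F : fieldType) (I J : finType) (A : I -> J -> F)
    (D : {set J}) :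
  (forall u : J -> F, (forall i, \sum_j A i j * u j = 0) ->
     (forall j, j \in D -> u j = 0) -> forall j, u j = 0) ->
  exists r (f : 'I_r -> I), (#|~: D| <= r)%N /\
    forall c : 'I_r -> F,
      (forall j, \sum_i c i * A (f i) j = 0) -> forall i, c i = 0.
Proof.
move=> inj; pose r := \rank (family_mx A); pose f := maxrankfun (family_mx A).
exists r, (fun i => enum_val (f i)); split; last first.
  move=> c c0 i; have : \row_k c k = 0.
    apply: (@row_free_inj _ 1 _ _ _ (maxrowsub_free (family_mx A))).
    rewrite /= mul0mx; apply/rowP => j; rewrite !mxE -[RHS](c0 (enum_val j)).
    by apply: eq_bigr => k _; rewrite !mxE.
  by move/rowP/(_ i); rewrite !mxE.
pose C : 'M[F]_(#|D|, #|J|) := \matrix_(i, j) (enum_val i == enum_val j)%:R.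
have : row_full (col_mx (family_mx A) C).
  rewrite /row_full -mxrank_tr; apply: inj_row_free => v.
  rewrite tr_col_mx mul_mx_row => /eqP; rewrite row_mx_eq0 => /andP[/eqP vA /eqP vC].
  apply/rowP => j; rewrite mxE -[j]enum_valK.
  apply: (inj (fun k => v 0 (enum_rank k))) => [i | k kD].
    have /rowP/(_ (enum_rank i)) := vA; rewrite !mxE => eq0; rewrite -[RHS]eq0 {eq0}.
    rewrite (reindex (@enum_val J J)) /=; last exact/onW_bij/enum_val_bij.
    by apply: eq_bigr => k _; rewrite !mxE enum_valK enum_rankK mulrC.
  have /rowP/(_ (enum_rank_in kD k)) := vC; rewrite !mxE => eq0; rewrite -[RHS]eq0 {eq0}.
  rewrite (bigD1 (enum_rank k)) //= big1 ?addr0 => [|l lk].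
    by rewrite !mxE enum_rankK_in // enum_rankK eqxx mulr1.
  rewrite !mxE enum_rankK_in // -(inj_eq enum_rank_inj) enum_valK eq_sym.
  by rewrite (negPf lk) mulr0.
rewrite /row_full => /eqP rk.
have : (#|J| <= r + #|D|)%N.
  rewrite -{1}rk -addsmxE (leq_trans (mxrank_adds_leqif _ _)) //.
  by rewrite leq_add2l rank_leq_row.
by rewrite -(cardsC D) addnC leq_add2r.
Qed.

(** Dimension count: the products of powers of the [P i] with exponents below [D] outnumber the
    monomials that can occur in them, so they satisfy a linear relation over the rationals, whose
    coefficients are those of [g]. *)
Lemma algebraic_dependence (m r : nat) (P : 'I_m -> {mpoly rat[r]}) : (r < m)%N ->
  exists2 g : {mpoly rat[m]}, g != 0 & mmap (@mpolyC r rat) P g = 0.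
Proof.
(* [c] bounds the sum of the degrees, so the products have degree at most [c * D]. The monomials
   number at most [(c * D + 1) ^ r <= (c + 1) ^ r * D ^ r], and [D] exceeds [(c + 1) ^ r], so this
   is below [D ^ (r + 1) <= D ^ m]. *)
move=> rm; pose c := (\sum_i msize (P i))%N; pose D := ((c.+1 ^ r).+1)%N.
pose E := {ffun 'I_m -> 'I_D}; pose C := {ffun 'I_r -> 'I_(c * D).+1}.
pose ex (h : E) : 'X_{1..m} := [multinom h i : nat | i < m].
pose cx (h : C) : 'X_{1..r} := [multinom h i : nat | i < r].
pose mon (h : E) := \prod_i P i ^+ h i.
pose A : 'M[rat]_(#|{: E}|, #|{: C}|) :=
  \matrix_(i, j) (mon (enum_val i))@_(cx (enum_val j)).
have card_lt : (#|{: C}| < #|{: E}|)%N.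
  rewrite !card_ffun !card_ord.
  have le1 : ((c * D).+1 ^ r <= (c.+1 * D) ^ r)%N.
    by case: (posnP r) => [->|r0]; rewrite ?expn0 ?leq_exp2r //; lia.
  apply: (leq_ltn_trans le1); rewrite expnMn.
  have lt2 : (c.+1 ^ r * D ^ r < D ^ r.+1)%N.
    by rewrite expnS ltn_pmul2r // expn_gt0.
  by apply: (leq_trans lt2); rewrite leq_pexp2l.
have kerA : kermx A != 0.
  rewrite kermx_eq0 /row_free neq_ltn.
  by rewrite (leq_ltn_trans (rank_leq_col A)).
have [v v0 vA] : exists2 v : 'rV_(#|{: E}|), v != 0 & v *m A = 0.
  case/rowV0Pn: kerA => v vker v0; exists v => //.
  exact/sub_kermxP.
pose g : {mpoly rat[m]} := \sum_i v 0 i *: 'X_[ex (enum_val i)].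
have ex_inj : injective ex.
  move=> h1 h2 /mnmP eqh; apply/ffunP => i; apply: val_inj.
  by have := eqh i; rewrite !mnmE.
have gcoef i : g@_(ex (enum_val i)) = v 0 i.
  rewrite /g raddf_sum /= (bigD1 i) //= big1 ?addr0 => [|j ji].
    by rewrite mcoeffZ mcoeffX eqxx mulr1.
  rewrite mcoeffZ mcoeffX (inj_eq ex_inj) (inj_eq enum_val_inj) (negPf ji).
  by rewrite mulr0.
exists g.
  apply: contra v0 => /eqP g0; apply/eqP/rowP => i.
  by rewrite mxE -gcoef g0 mcoeff0.
have evg : mmap (@mpolyC r rat) P g = \sum_i v 0 i *: mon (enum_val i).
  rewrite /g raddf_sum /=; apply: eq_bigr => i _.
  rewrite mmapZ mmapX mul_mpolyC; congr (_ *: _).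
  by apply: eq_bigr => j _; rewrite mnmE.
have szM (p q : {mpoly rat[r]}) : (msize (p * q) <= (msize p + msize q).-1)%N.
  have [->|p0] := eqVneq p 0; first by rewrite mul0r msize0.
  have [->|q0] := eqVneq q 0; first by rewrite mulr0 msize0.
  by rewrite msizeM.
have szmon h : (msize (mon h) <= (c * D).+1)%N.
  have szX (q : {mpoly rat[r]}) k : (msize (q ^+ k) <= (msize q * k).+1)%N.
    elim: k => [|k IH]; first by rewrite expr0 msize1 muln0.
    rewrite exprS; apply: (leq_trans (szM _ _)); lia.
  rewrite /mon /c big_distrl /=.
  apply: (@big_ind2 _ _ (fun q (s : nat) => msize q <= s.+1)%N).
  - by rewrite msize1.
  - by move=> q1 s1 q2 s2 h1 h2; apply: (leq_trans (szM _ _)); lia.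
  - move=> i _; apply: (leq_trans (szX _ _)); rewrite ltnS leq_mul2l.
    by rewrite (ltnW (ltn_ord _)) orbT.
rewrite evg; apply/mpolyP => k; rewrite mcoeff0 raddf_sum /=.
have [small | big] := leqP (mdeg k) (c * D); last first.
  rewrite big1 // => i _; rewrite mcoeffZ memN_msupp_eq0 ?mulr0 //.
  by apply: msize_mdeg_ge; apply: leq_trans big.
have kle i : (k i < (c * D).+1)%N.
  rewrite ltnS (leq_trans _ small) // mdegE (bigD1 i) //=; exact: leq_addr.
pose kk : C := [ffun i => Ordinal (kle i)].
have -> : k = cx kk by apply/mnmP => i; rewrite mnmE ffunE.
have /rowP/(_ (enum_rank kk)) := vA; rewrite !mxE => eq0; rewrite -[RHS]eq0 {eq0}.
by apply: eq_bigr => i _; rewrite mcoeffZ !mxE enum_rankK.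
Qed.

(** * Sparse graphs *)

Ltac card_lia :=
  repeat match goal with |- context[@fintype.card ?U ?A] =>
    let n := fresh "n" in move: (@fintype.card U A) => n end; clear; lia.

Section Sparse.
Local Open Scope nat_scope.
Variable T : finType.
Implicit Types (B E : {set T * T}) (X Y Z W : {set T}).

Definition induced B X := [set f in B | (f.1 \in X) && (f.2 \in X)].
(* Truncated subtraction: a sparse set has no loops, as the bound is 0 when #|X| = 1. *)
Definition sparse B := forall X, #|induced B X| <= 2 * #|X| - 3.
Definition tight B X := (1 < #|X|) && (2 * #|X| <= #|induced B X| + 3).
Definition adj B s t := ((s, t) \in B) || ((t, s) \in B).
Definition incident B v := [set f in B | (f.1 == v) || (f.2 == v)].

Lemma in_induced B X f :
  (f \in induced B X) = [&& f \in B, f.1 \in X & f.2 \in X].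
Proof. by rewrite inE. Qed.

Lemma inducedS B E X Y : B \subset E -> X \subset Y -> induced B X \subset induced E Y.
Proof.
move=> /subsetP BE /subsetP XY; apply/subsetP => f; rewrite !in_induced.
by move=> /and3P[/BE -> /XY -> /XY ->].
Qed.

Lemma inducedI B X Y : induced B X :&: induced B Y = induced B (X :&: Y).
Proof.
apply/setP => f; rewrite inE !in_induced !inE.
by case: (f \in B); case: (f.1 \in X); case: (f.2 \in X); rewrite ?andbF.
Qed.

Lemma sparseS B E : B \subset E -> sparse E -> sparse B.
Proof.
by move=> BE sE X; apply: leq_trans (sE X); apply/subset_leq_card/inducedS.
Qed.

(** The number of induced edges is supermodular, and sparsity bounds it on the intersection, which
    has at least two vertices. *)
Lemma tightU B X Y : sparse B -> tight B X -> tight B Y -> 1 < #|X :&: Y| ->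
  tight B (X :|: Y).
Proof.
move=> sB /andP[X1 tX] /andP[Y1 tY] XY.
have cU := cardsUI X Y; have cE := cardsUI (induced B X) (induced B Y).
have sI := sB (X :&: Y); rewrite -inducedI in sI.
have sU : #|induced B X :|: induced B Y| <= #|induced B (X :|: Y)|.
  by apply: subset_leq_card; rewrite subUset !inducedS ?subsetUl ?subsetUr.
have := subset_leq_card (subsetUl X Y).
by move: X1 tX Y1 tY XY cU cE sI sU; rewrite /tight; card_lia.
Qed.

(** If two of the sets share two vertices, their union is tight and meets the third in two vertices,
    so [tightU] applies twice. Otherwise the induced edge sets are disjoint, the union has three
    vertices fewer than the sizes add up to, and the three bounds [2n - 3] add up to one. *)
Lemma tight_triangle B X Y Z a b c : sparse B ->
  tight B X -> tight B Y -> tight B Z ->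
  a \in X -> b \in X -> b \in Y -> c \in Y -> a \in Z -> c \in Z ->
  a != b -> b != c -> a != c -> tight B (X :|: Y :|: Z).
Proof.
move=> sB tX tY tZ aX bX bY cY aZ cZ ab bc ac.
have card2 (U : {set T}) x y : x \in U -> y \in U -> x != y -> 1 < #|U|.
  by move=> xU yU xy; apply/card_gt1P; exists x, y.
have [XY|XY] := ltnP 1 #|X :&: Y|.
  apply: tightU => //; first exact: tightU.
  by apply: (card2 _ a c) => //; rewrite !inE ?aX ?aZ ?cY ?cZ ?orbT.
have [YZ|YZ] := ltnP 1 #|Y :&: Z|.
  rewrite -setUA; apply: tightU => //; first exact: tightU.
  by apply: (card2 _ a b) => //; rewrite !inE ?aX ?aZ ?bX ?bY ?orbT.
have [XZ|XZ] := ltnP 1 #|X :&: Z|.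
  rewrite setUAC; apply: tightU => //; first exact: tightU.
  by apply: (card2 _ b c) => //; rewrite !inE ?bX ?bY ?cY ?cZ ?orbT.
have ind0 U V : #|U :&: V| <= 1 -> induced B U :&: induced B V = set0.
  move=> UV; apply/eqP; rewrite inducedI -cards_eq0 -leqn0.
  by apply: (leq_trans (sB _)); move: UV; card_lia.
have cI : #|(induced B X :|: induced B Y) :&: induced B Z| = 0.
  by rewrite setIUl !ind0 // setU0 cards0.
have cI' : #|induced B X :&: induced B Y| = 0 by rewrite ind0 // cards0.
have sU : #|induced B X :|: induced B Y :|: induced B Z| <=
    #|induced B (X :|: Y :|: Z)|.
  apply: subset_leq_card; rewrite !subUset !inducedS //.
  - by rewrite subsetUr.
  - by rewrite -setUA setUCA subsetUl.
  - by rewrite -setUA subsetUl.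
have := cardsUI (induced B X :|: induced B Y) (induced B Z).
have := cardsUI (induced B X) (induced B Y).
have := cardsUI X Y; have := cardsUI (X :|: Y) Z.
have : 0 < #|X :&: Y| by apply/card_gt0P; exists b; rewrite inE bX.
have : 1 < #|(X :|: Y) :&: Z|.
  by apply: (card2 _ a c) => //; rewrite !inE ?aX ?aZ ?cY ?cZ ?orbT.
have := subset_leq_card (subsetUl (X :|: Y) Z).
have := subset_leq_card (subsetUl X Y).
case/andP: tX tY tZ => X1 tX /andP[Y1 tY] /andP[Z1 tZ].
by move: cI cI' sU XY X1 tX Y1 tY Z1 tZ; rewrite /tight; card_lia.
Qed.

Lemma sparse_edge_neq B s t : sparse B -> (s, t) \in B -> s != t.
Proof.
move=> sB stB; apply/eqP => eq_st; have := sB [set s]; rewrite cards1 leqn0.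
by rewrite cards_eq0 => /eqP/setP/(_ (s, t)); rewrite !inE stB eq_st eqxx.
Qed.

Lemma sparse_edge_asym B s t : sparse B -> (s, t) \in B -> (t, s) \notin B.
Proof.
move=> sB stB; apply/negP => tsB; have ne := sparse_edge_neq sB stB.
have := sB [set s; t]; rewrite cards2 ne /= => le1.
rewrite leqNgt in le1; case/negP: le1.
apply/card_gt1P; exists (s, t), (t, s).
rewrite !in_induced !inE stB tsB !eqxx ?orbT /=; split => //.
by apply: contra ne => /eqP[->].
Qed.

Lemma card_incident B v : sparse B ->
  #|incident B v| = #|[set x | adj B v x]|.
Proof.
move=> sB; pose g (f : T * T) := if f.1 == v then f.2 else f.1.
rewrite -(card_in_imset (f := g)).
  congr #|pred_of_set _|; apply/setP => x; rewrite inE; apply/imsetP/orP.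
    case=> [[s t]]; rewrite !inE /= => /andP[stB].
    rewrite /g /=; have [sv _ ->|sv] := eqVneq s v; first by left; rewrite -sv.
    by move=> /eqP tv ->; right; rewrite -tv.
  case=> [vx|xv].
    by exists (v, x); rewrite /g ?inE ?vx /= eqxx.
  exists (x, v); rewrite /g ?inE ?xv /= ?eqxx ?orbT //.
  by rewrite (negPf (sparse_edge_neq sB xv)).
move=> [s t] [s' t']; rewrite !inE /g /= => /andP[B1 h1] /andP[B2 h2].
have [e1|n1] := eqVneq s v; have [e2|n2] := eqVneq s' v.
- by rewrite e1 e2 => ->.
- move=> e; move: h2; rewrite (negPf n2) /= => /eqP e2; subst.
  by move: (sparse_edge_asym sB B1); rewrite B2.
- move=> e; move: h1; rewrite (negPf n1) /= => /eqP e1; subst.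
  by move: (sparse_edge_asym sB B1); rewrite B2.
- by move: h1 h2; rewrite (negPf n1) (negPf n2) /= => /eqP -> /eqP -> ->.
Qed.

Lemma sum_incident B : sparse B -> \sum_v #|incident B v| = 2 * #|B|.
Proof.
move=> sB.
transitivity (\sum_v \sum_(f in B) ((f.1 == v) || (f.2 == v) : nat)).
  apply: eq_bigr => v _; rewrite -sum1_card big_mkcond [RHS]big_mkcond /=.
  by apply: eq_bigr => f _; rewrite inE; case: (f \in B) => //; case: orb.
rewrite exchange_big /= -sum1_card big_distrr /=; apply: eq_bigr => -[s t] stB /=.
have ne := sparse_edge_neq sB stB.
rewrite (bigD1 s) //= (bigD1 t) /=; last by rewrite eq_sym.
rewrite !eqxx orbT big1 // => x /andP[xs xt].
by rewrite eq_sym (negPf xs) eq_sym (negPf xt).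
Qed.

Lemma card_induced_del B W v :
  {subset B <= setX W W} ->
  #|induced B (W :\ v)| + #|incident B v| = #|B|.
Proof.
move=> BW; rewrite addnC -(cardsID (incident B v) B); congr (_ + _); apply: eq_card => f.
  by rewrite !inE; case: (f \in B).
rewrite !inE; have [fB|] := boolP (f \in B); last by rewrite andbF.
by have := BW f fB; rewrite inE => /andP[-> ->]; rewrite negb_or !andbT.
Qed.

Lemma sparse_add_edge B a b : sparse B -> a != b ->
  (forall X, tight B X -> ~~ ((a \in X) && (b \in X))) -> sparse ((a, b) |: B).
Proof.
move=> sB ab ntight X; have [/andP[aX bX]|abX] := boolP ((a \in X) && (b \in X)).
  have X1 : 1 < #|X| by apply/card_gt1P; exists a, b.
  have : ~~ tight B X by apply: contraL (isT) => /ntight; rewrite aX bX.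
  have : #|induced ((a, b) |: B) X| <= #|induced B X| + 1.
    rewrite -(cards1 (a, b)) addnC; apply: leq_trans (leq_card_setU _ _).
    apply/subset_leq_card/subsetP => f; rewrite !inE => /and3P[/orP[->//|->] -> ->].
    by rewrite orbT.
  by move: X1; rewrite /tight; card_lia.
apply: leq_trans (sB X); apply/subset_leq_card/subsetP => f; rewrite !inE.
move=> /and3P[/orP[/eqP->|->]] /= h1 h2; last by rewrite h1 h2.
by rewrite h1 h2 in abX.
Qed.

Lemma induced_id B W : B \subset setX W W -> induced B W = B.
Proof.
move=> /subsetP BW; apply/setP => f; rewrite in_induced.
by have [/BW|//] := boolP (f \in B); rewrite inE => /andP[-> ->].
Qed.

(** Inverse Henneberg moves, the inductive step for Laman's theorem. An average degree below 4 gives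
    a vertex [v] of degree at most 3. At degree 2 it is deleted; at degree 3 an edge between two
    neighbours replaces it, as the three pairs of neighbours cannot all lie in tight sets of the
    graph without [v]. *)
Lemma henneberg B W : sparse B -> B \subset setX W W -> tight B W -> 2 < #|W| ->
  exists2 v, v \in W &
    (exists a b, [/\ a \in W :\ v, b \in W :\ v, a != b, adj B v a & adj B v b]
       /\ tight B (W :\ v)) \/
    (exists a b c, [/\ a \in W :\ v, b \in W :\ v & c \in W :\ v] /\
       [/\ a != b, a != c & b != c] /\ [/\ adj B v a, adj B v b & adj B v c] /\
       sparse ((a, b) |: induced B (W :\ v)) /\
       tight ((a, b) |: induced B (W :\ v)) (W :\ v)).
Proof.
move=> sB BW /andP[_ tW] W2; rewrite (induced_id BW) in tW.
have cB : #|B| <= 2 * #|W| - 3 by rewrite -{1}(induced_id BW).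
have [v vW dv] : exists2 v, v \in W & #|incident B v| <= 3.
  apply/exists_inP; apply: contraT; rewrite negb_exists_in => /forall_inP big.
  have : #|W| * 4 <= 2 * #|B|.
    rewrite -(sum_incident sB) (bigID (mem W)) /= -sum_nat_const.
    rewrite (leq_trans _ (leq_addr _ _)) //; apply: leq_sum => v vW.
    by rewrite ltnNge big.
  by move: cB W2; card_lia.
have BW' : {subset B <= setX W W} by apply/subsetP.
exists v => //; have eqB := card_induced_del v BW'.
have cv := card_incident v sB; set nb := [set x | adj B v x] in cv.
have cW : #|W| = #|W :\ v|.+1 by rewrite (cardsD1 v) vW.
have sv := sB (W :\ v).
have nbW x : x \in nb -> x \in W :\ v.
  rewrite !inE => /orP[] h; have := BW' _ h; rewrite inE /= => /andP[h1 h2].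
    by rewrite h2 eq_sym (sparse_edge_neq sB h).
  by rewrite h1 (sparse_edge_neq sB h).
have nbadj x : x \in nb -> adj B v x by rewrite inE.
have [d2|d3] : #|nb| = 2 \/ #|nb| = 3.
  by move: dv tW W2 eqB cv sv cW; clear; card_lia.
  left; have /eqP/cards2P[a [b [ab nbE]]] := d2.
  have anb : a \in nb by rewrite nbE !inE eqxx.
  have bnb : b \in nb by rewrite nbE !inE eqxx orbT.
  exists a, b; split; first by split=> //; auto.
  by move: tW W2 eqB cv cW d2; rewrite /tight; clear; card_lia.
right.
have /card_gt2P[a [b [c [[anb bnb cnb] [ab bc ca]]]]] : 2 < #|nb| by rewrite d3.
have nbE : nb \subset [set a; b; c].
  suff -> : nb = [set a; b; c] by [].
  apply/esym/eqP; rewrite eqEcard d3; apply/andP; split.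
    by apply/subsetP => x; rewrite !inE -orbA => /or3P[] /eqP->;
       move: anb bnb cnb; rewrite !inE.
  by rewrite setUC cardsU1 !inE cards2 ab negb_or ca eq_sym bc.
set B0 := induced B (W :\ v).
have sB0 : sparse B0.
  by apply: sparseS sB; apply/subsetP => f; rewrite inE => /andP[].
(* Adding [v] with its three edges to such a [U] would exceed the sparsity bound, which one vertex
   raises by 2 only. *)
have noU U : tight B0 U -> a \in U -> b \in U -> c \in U -> false.
  move=> /andP[U1 tU] aU bU cU.
  have nbU : nb \subset U.
    by apply: (subset_trans nbE); rewrite !subUset !sub1set aU bU cU.
  have : #|induced B0 U| + #|incident B v| <= #|induced B (v |: U)|.
    rewrite -cardsUI.
    have -> : induced B0 U :&: incident B v = set0.
      apply/setP => f; rewrite !inE; apply/negP => /andP[].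
      move=> /andP[/and3P[_ /andP[n1 _] /andP[n2 _]] _] /andP[_].
      by rewrite (negPf n1) (negPf n2).
    rewrite cards0 addn0; apply/subset_leq_card/subsetP => f.
    rewrite !inE => /orP[/and3P[/and3P[-> _ _] -> ->]|/andP[fB h]].
      by rewrite !orbT.
    rewrite fB /=; have nU x : adj B v x -> x \in U.
      by move=> vx; apply: (subsetP nbU); rewrite inE.
    case: f fB h => s t /= fB /orP[/eqP e|/eqP e]; subst; rewrite eqxx /=.
      by rewrite (nU t) ?orbT // /adj fB.
    by rewrite (nU s) ?orbT // /adj fB orbT.
  have := sB (v |: U); rewrite cardsU1.
  move: tU U1 d3 cv; case: (v \notin U); card_lia.
pose P x y := [exists U : {set T}, [&& tight B0 U, x \in U & y \in U]].
have nP x y z : x \in nb -> y \in nb -> z \in nb -> x != y -> x != z -> y != z ->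
  ~~ P x y ->
  exists a b c, [/\ a \in W :\ v, b \in W :\ v & c \in W :\ v] /\
       [/\ a != b, a != c & b != c] /\ [/\ adj B v a, adj B v b & adj B v c] /\
       sparse ((a, b) |: B0) /\
       tight ((a, b) |: B0) (W :\ v).
  move=> xn yn zn xy xz yz; rewrite negb_exists => /forallP nPxy.
  have xW := nbW _ xn; have yW := nbW _ yn.
  have notight U : tight B0 U -> ~~ ((x \in U) && (y \in U)).
    by move=> tU; have := nPxy U; rewrite tU.
  exists x, y, z; split; first by split; auto.
  do 2![split; first by split; auto].
  split; first exact: sparse_add_edge.
  have -> : tight ((x, y) |: B0) (W :\ v) =
    (1 < #|W :\ v|) && (2 * #|W :\ v| <= #|(x, y) |: B0| + 3).
    rewrite /tight induced_id // subUset sub1set in_setX xW yW /=.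
    by apply/subsetP => [[s t]]; rewrite in_induced in_setX => /andP[_].
  rewrite cardsU1; have -> : (x, y) \notin B0.
    apply/negP => xyB; have := notight [set x; y]; rewrite !inE !eqxx orbT /=.
    suff -> : tight B0 [set x; y] by move/(_ isT).
    rewrite /tight cards2 xy /=.
    suff : 0 < #|induced B0 [set x; y]| by card_lia.
    by apply/card_gt0P; exists (x, y); rewrite in_induced xyB !inE !eqxx orbT.
  by move: tW W2 eqB cv cW d3; rewrite -/B0; clear; card_lia.
have [/existsP[X /and3P[tX aX bX]]|] := boolP (P a b); last first.
  by apply: (nP a b c) => //; rewrite eq_sym.
have [/existsP[Y /and3P[tY bY cY]]|] := boolP (P b c); last first.
  by apply: (nP b c a) => //; rewrite eq_sym.
have [/existsP[Z /and3P[tZ aZ cZ]]|] := boolP (P a c); last first.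
  by apply: (nP a c b) => //; rewrite eq_sym.
have ac : a != c by rewrite eq_sym.
have tU := tight_triangle sB0 tX tY tZ aX bX bY cY aZ cZ ab bc ac.
by have := noU _ tU; rewrite !inE aX bX cY ?orbT => /(_ isT isT isT).
Qed.

(** A certificate of flexibility: [2 * #|X| - 3] is the rank of a complete graph on [X] in the plane
    rigidity matroid, so the last clause bounds the rank of the graph on [W] below
    [2 * #|W| - 3]. *)
Definition cover_below W (e : rel T) (XX : {set {set T}}) :=
  [/\ forall X, X \in XX ->
        [/\ X \subset W, 1 < #|X| &
            exists s t, [/\ s \in X, t \in X, s != t & e s t]],
      forall X Y, X \in XX -> Y \in XX -> X != Y -> #|X :&: Y| <= 1,
      forall s t, s \in W -> t \in W -> s != t -> e s t ->
        exists2 X, X \in XX & (s \in X) && (t \in X),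
      forall r s t, [/\ r \in W, s \in W & t \in W] ->
        [/\ r != s, s != t & r != t] -> [/\ e r s, e s t & e r t] ->
        exists2 X, X \in XX & [&& r \in X, s \in X & t \in X] &
      \sum_(X in XX) (2 * #|X| - 3) + 3 < 2 * #|W|].

(** If a maximal sparse set [B] of edges is not tight on [W], its maximal tight sets form the cover:
    they overlap in at most one vertex by [tightU], hold every edge by maximality of [B] and every
    triangle by [tight_triangle], and no edge of [B] is counted twice. *)
Lemma sparse_basis_or_cover W (e : rel T) : 1 < #|W| ->
  (exists B, [/\ B \subset setX W W, {in B, forall f, e f.1 f.2}, sparse B &
                 tight B W]) \/
  exists XX, cover_below W e XX.
Proof.
move=> W1; pose E := [set f in setX W W | (f.1 != f.2) && e f.1 f.2].
pose Q B := (B \subset E) && [forall X, #|induced B X| <= 2 * #|X| - 3].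
have Q0 : Q set0.
  rewrite /Q sub0set; apply/forallP => X; suff -> : induced set0 X = set0.
    by rewrite cards0.
  by apply/setP => f; rewrite !inE.
have [B /maxsetP[/andP[BE /forallP sB] maxB] _] := maxset_exists Q0.
have BW : B \subset setX W W.
  by apply: (subset_trans BE); apply/subsetP => f; rewrite inE => /andP[].
have [tW|ntW] := boolP (tight B W).
  left; exists B; split=> // f /(subsetP BE); rewrite inE => /andP[_ /andP[]] //.
right; pose Pt X := tight B X && (X \subset W).
pose XX := [set X | maxset Pt X]; exists XX.
have XXP X : X \in XX -> [/\ tight B X, X \subset W &
    forall Y, tight B Y -> Y \subset W -> X \subset Y -> Y = X].
  rewrite inE => /maxsetP[/andP[tX XW] mX]; split=> // Y tY YW; apply: mX.
  by rewrite /Pt tY.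
have XXex X : tight B X -> X \subset W -> exists2 Y, Y \in XX & X \subset Y.
  move=> tX XW; have [Y mY XY] := @maxset_exists _ Pt X (introT andP (conj tX XW)).
  by exists Y; rewrite ?inE.
have XXI X Y : X \in XX -> Y \in XX -> X != Y -> #|X :&: Y| <= 1.
  move=> /XXP[tX XW mX] /XXP[tY YW mY]; apply: contraR; rewrite -ltnNge => c1.
  have tU := tightU sB tX tY c1.
  have UW : X :|: Y \subset W by rewrite subUset XW.
  by rewrite -(mX _ tU UW (subsetUl _ _)) (mY _ tU UW (subsetUr _ _)).
have edge_tight s t : s \in W -> t \in W -> s != t -> e s t ->
    exists2 X, X \in XX & (s \in X) && (t \in X).
  move=> sW tW st est.
  suff [X tX /andP[sX tX']] : exists2 X, tight B X & (s \in X) && (t \in X).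
    have tXW : tight B (X :&: W).
      have eqI : induced B (X :&: W) = induced B X.
        by rewrite -inducedI (induced_id BW); apply/setIidPl/subsetP => f;
           rewrite inE => /andP[].
      case/andP: tX => _ tX; apply/andP; split.
        by apply/card_gt1P; exists s, t; rewrite !inE sX tX' sW tW.
      rewrite eqI; apply: leq_trans tX; rewrite leq_mul2l.
      by rewrite subset_leq_card ?orbT ?subsetIl.
    have [Y YX XY] := XXex _ tXW (subsetIr _ _).
    by exists Y => //; rewrite !(subsetP XY) // inE ?sX ?tX' ?sW ?tW.
  have [stB|stB] := boolP ((s, t) \in B).
    exists [set s; t]; last by rewrite !inE !eqxx orbT.
    rewrite /tight cards2 st /=.
    suff : 0 < #|induced B [set s; t]| by card_lia.
    by apply/card_gt0P; exists (s, t); rewrite in_induced stB !inE !eqxx orbT.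
  have [/existsP[X /and3P[tX sX tX']]|noX] :=
    boolP [exists X : {set T}, [&& tight B X, s \in X & t \in X]].
    by exists X; rewrite ?sX.
  have sB' : sparse ((s, t) |: B).
    apply: sparse_add_edge => // X tX; apply: contra noX => sXt.
    by apply/existsP; exists X; rewrite tX.
  have : (s, t) |: B = B.
    apply: maxB; last exact: subsetUr.
    rewrite /Q subUset BE sub1set !inE sW tW st est /=; exact/forallP.
  by move/setP/(_ (s, t)); rewrite !inE eqxx (negPf stB).
split=> //.
- move=> X /XXP[/andP[X1 tX] XW _]; split=> //.
  have : 0 < #|induced B X| by move: X1 tX; card_lia.
  case/card_gt0P => -[s t]; rewrite in_induced => /and3P[stB sX tX'].
  exists s, t; split=> //; first exact: sparse_edge_neq stB.
  by have := subsetP BE _ stB; rewrite inE => /andP[_ /andP[]].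
- move=> r s t [rW sW tW] [rs st rt] [ers est ert].
  have [X XX' /andP[rX sX]] := edge_tight _ _ rW sW rs ers.
  have [Y YY /andP[sY tY]] := edge_tight _ _ sW tW st est.
  have [Z ZZ /andP[rZ tZ]] := edge_tight _ _ rW tW rt ert.
  exists X => //; rewrite rX sX /=.
  have [tiX XW mX] := XXP _ XX'; have [tiY YW _] := XXP _ YY.
  have [tiZ ZW _] := XXP _ ZZ.
  have tU := tight_triangle sB tiX tiY tiZ rX sX sY tY rZ tZ rs st rt.
  rewrite -(mX _ tU); first by rewrite !inE tY orbT.
    by rewrite !subUset XW YW ZW.
  by rewrite -setUA subsetUl.
have ltB : #|B| + 3 < 2 * #|W|.
  by move: ntW; rewrite /tight W1 (induced_id BW) -ltnNge.
apply: leq_ltn_trans ltB; rewrite leq_add2r.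
apply: (@leq_trans (\sum_(X in XX) #|induced B X|)); last first.
  have -> : \sum_(X in XX) #|induced B X| =
      \sum_(X in XX) \sum_(f in B) (f \in induced B X : nat).
    apply: eq_bigr => X _; rewrite -sum1_card big_mkcond.
    by rewrite [RHS]big_mkcond; apply: eq_bigr => f _; rewrite in_induced; case: (f \in B).
  rewrite exchange_big /= -sum1_card; apply: leq_sum => f fB.
  rewrite -big_mkcondr sum1_card; apply/card_le1_eqP => X Y.
  rewrite -!topredE /= !in_induced fB /= => /andP[XX' /andP[X1 X2]] /andP[YY /andP[Y1 Y2]].
  apply: contraTeq (sB (X :&: Y)) ; rewrite eq_sym => XY; rewrite -ltnNge.
  apply: (@leq_ltn_trans 0); first by move: (XXI _ _ XX' YY XY); card_lia.
  by apply/card_gt0P; exists f; rewrite in_induced fB !inE X1 X2 Y1 Y2.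
apply: leq_sum => X /XXP[/andP[_ tX] _ _].
by move: tX; card_lia.
Qed.
End Sparse.

(** * Infinitesimal rigidity at a generic configuration *)

Lemma linear_system2 (F : fieldType) (a b c d x y : F) : a * d - b * c != 0 ->
  a * x + b * y = 0 -> c * x + d * y = 0 -> x = 0 /\ y = 0.
Proof.
move=> det0 e1 e2; split; apply: (mulfI det0); rewrite mulr0.
  transitivity (d * (a * x + b * y) - b * (c * x + d * y)); first by ring.
  by rewrite e1 e2 !mulr0 subr0.
transitivity (a * (c * x + d * y) - c * (a * x + b * y)); first by ring.
by rewrite e1 e2 !mulr0 subr0.
Qed.

Section Rigidity.
Variables (R : realType) (N : nat).
Local Notation T := 'I_N.
(* The two coordinates of a point are indexed by [false] and [true]. *)
Local Notation config := (T -> bool -> R).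
Implicit Types (p q u : config) (e : rel T) (W : {set T}).

Definition coord p (j : 'I_(N * 2)) : R :=
  mxvec (\matrix_(k < N, c < 2) p k (c == 1)) 0 j.
Definition ev p : {mpoly rat[N * 2]} -> R := mmap (ratr : rat -> R) (coord p).
HB.instance Definition _ p := GRing.RMorphism.on (ev p).

Definition var (k : T) (b : bool) : {mpoly rat[N * 2]} :=
  'X_(mxvec_index k (if b then 1 else 0)).
Definition generic_config p := forall G, G != 0 -> ev p G != 0.

Lemma ev_var p k b : ev p (var k b) = p k b.
Proof. by rewrite /ev /var mmapX mmap1U /coord mxvecE mxE; case: b. Qed.

(** Reduces nonvanishing at a generic configuration to one conveniently chosen configuration. *)
Lemma generic_nonzero p p0 G : generic_config p -> ev p0 G != 0 -> ev p G != 0.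
Proof.
by move=> gp h; apply: gp; apply: contra h => /eqP ->; rewrite rmorph0.
Qed.

Lemma generic_coord_neq p s t b : generic_config p -> s != t -> p s b - p t b != 0.
Proof.
move=> gp st; rewrite -!(ev_var p) -rmorphB.
apply: (@generic_nonzero _ (fun k _ => (k == s)%:R)) => //.
by rewrite rmorphB /= !ev_var eqxx [t == s]eq_sym (negPf st) subr0 oner_eq0.
Qed.

Definition area p r s t :=
  (p s false - p r false) * (p t true - p r true) -
  (p s true - p r true) * (p t false - p r false).

Lemma generic_area p r s t : generic_config p ->
  r != s -> s != t -> r != t -> area p r s t != 0.
Proof.
move=> gp rs st rt; rewrite /area -!(ev_var p) -!(rmorphB, rmorphM) /=.
(* Test configuration: [s] at (1, 0), [t] at (0, 1), every other vertex at the origin. *)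
apply: (@generic_nonzero _ (fun k b => (k == if b then t else s)%:R)) => //.
rewrite !(rmorphB, rmorphM) /= !ev_var !eqxx (negPf rs) (negPf rt) (negPf st).
by rewrite !subr0 mul0r subr0 mulr1 oner_eq0.
Qed.

(** Half the rate of change of the squared length of [s]-[t] under the velocity [u]; with [u := p]
    it is the squared length itself. *)
Definition dot p u (s t : T) :=
  (p s false - p t false) * (u s false - u t false) +
  (p s true - p t true) * (u s true - u t true).

Lemma dot_sym p u s t : dot p u s t = dot p u t s.
Proof. by rewrite /dot; ring. Qed.

Definition flex W e p u := {in W &, forall s t, e s t -> dot p u s t = 0}.

(** Infinitesimal rotation with angular velocity [w], plus translation by [(x, y)]. *)
Definition trivial_motion W p u := exists w x y,
  {in W, forall k, u k false = x - w * p k true /\ u k true = y + w * p k false}.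

Definition rigid W e p := forall u, flex W e p u -> trivial_motion W p u.

(** Freezes the vertices outside [W], all of [a] and the second coordinate of [b]. If [a] and [b]
    are in [W] and differ in the first coordinate, this kills the three-dimensional space of trivial
    motions and leaves [2 * #|W| - 3] unknowns. *)
Definition pins W (a b : T) : {set T * bool} :=
  [set kc | [|| kc.1 \notin W, kc.1 == a | (kc.1 == b) && kc.2]].

Definition pinned_rigid W e p a b := forall u, flex W e p u ->
  (forall kc, kc \in pins W a b -> u kc.1 kc.2 = 0) -> forall k c, u k c = 0.

Lemma trivial_motion_dot W p u s t : trivial_motion W p u ->
  s \in W -> t \in W -> dot p u s t = 0.
Proof.
move=> [w [x [y h]]] /h[s1 s2] /h[t1 t2].
by rewrite /dot s1 s2 t1 t2; ring.
Qed.

Lemma trivial_motion_zero W p u a b : trivial_motion W p u ->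
  a \in W -> b \in W -> p a false - p b false != 0 ->
  (forall c, u a c = 0) -> u b true = 0 -> {in W, forall k c, u k c = 0}.
Proof.
move=> [w [x [y h]]] aW bW ab ua ub k kW c.
have [a1 a2] := h a aW; have [_ b2] := h b bW.
have w0 : w = 0.
  apply/eqP; move: ab; apply: contraNT => w0; apply/eqP.
  by apply: (mulfI w0); rewrite mulr0; move: a2 b2; rewrite ua ub; lra.
have [k1 k2] := h k kW; move: a1 a2; rewrite !ua w0 => a1 a2.
by case: c; rewrite ?k1 ?k2 w0; lra.
Qed.

Lemma rigid_pinned W e p a b : a \in W -> b \in W -> p a false - p b false != 0 ->
  rigid W e p -> pinned_rigid W e p a b.
Proof.
move=> aW bW ab rW u /rW tu pin k c.
have pz l d : (l, d) \in pins W a b -> u l d = 0 by move/pin.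
have [kW|kW] := boolP (k \in W); last by apply: pz; rewrite inE /= kW.
apply: (trivial_motion_zero tu aW bW ab) kW c => [d|]; apply: pz.
  by rewrite inE /= eqxx orbT.
by rewrite inE /= eqxx /= !orbT.
Qed.

Lemma rigid_of_pinned W e p a b : a \in W -> b \in W -> p a false - p b false != 0 ->
  pinned_rigid W e p a b -> rigid W e p.
Proof.
move=> aW bW ab pr u fu.
pose w := (u a true - u b true) / (p a false - p b false).
pose x := u a false + w * p a true; pose y := u a true - w * p a false.
pose m k c := if c then y + w * p k false else x - w * p k true.
pose u' k c := if k \in W then u k c - m k c else 0.
exists w, x, y => k kW.
suff h c : u' k c = 0.
  move: (h false) (h true); rewrite /u' kW /m => h1 h2; split; lra.
apply: pr => [s t sW tW est | [l d]].
  have := fu s t sW tW est; rewrite /dot /u' sW tW /m => <-; ring.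
rewrite inE /= /u' => /or3P[/negPf->// | /eqP-> | /andP[/eqP-> ->]].
  by rewrite aW /m /x /y; case: d; ring.
rewrite bW /m /y; have : w * (p a false - p b false) = u a true - u b true.
  by rewrite /w divfK.
by lra.
Qed.

(** Row of the rigidity matrix, over any ring so that it can be taken at the polynomial variables as
    well as at real points. *)
Definition edge_row (K : pzRingType) (p : T -> bool -> K) (s t : T) (kc : T * bool) : K :=
  (p s kc.2 - p t kc.2) * ((kc.1 == s)%:R - (kc.1 == t)%:R).

Lemma sum_edge_row p u s t :
  \sum_kc edge_row p s t kc * u kc.1 kc.2 = dot p u s t.
Proof.
have diff c : \sum_k (((k == s)%:R - (k == t)%:R) * u k c) = u s c - u t c.
  under eq_bigr do rewrite mulrBl.
  have one r : \sum_k ((k == r)%:R * u k c) = u r c.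
    rewrite (bigD1 r) //= eqxx mul1r big1 ?addr0 // => k /negPf ->.
    by rewrite mul0r.
  by rewrite sumrB !one.
transitivity (\sum_k \sum_c edge_row p s t (k, c) * u k c).
  by rewrite pair_big /=; apply: eq_bigr => -[].
rewrite exchange_big /= big_bool /= /edge_row /=.
under eq_bigr do rewrite -mulrA.
rewrite -mulr_sumr diff.
under eq_bigr do rewrite -mulrA.
by rewrite -mulr_sumr diff addrC.
Qed.

(** Pinned rigidity is injectivity of a linear system with polynomial entries, so it passes from any
    [p0], even a degenerate one, to the generic [p]. *)
Lemma pinned_specialization W e p p0 a b : generic_config p ->
  pinned_rigid W e p0 a b -> pinned_rigid W e p a b.
Proof.
move=> gp pr0.
pose A (i : (T * T) + (T * bool)) (kc : T * bool) : {mpoly rat[N * 2]} :=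
  match i with
  | inl st => if [&& st.1 \in W, st.2 \in W & e st.1 st.2]
              then edge_row var st.1 st.2 kc else 0
  | inr i => if i \in pins W a b then (kc == i)%:R else 0
  end.
have evA q u : (forall i, \sum_kc ev q (A i kc) * u kc.1 kc.2 = 0) <->
   flex W e q u /\ (forall kc, kc \in pins W a b -> u kc.1 kc.2 = 0).
  have evl s t : [&& s \in W, t \in W & e s t] ->
      \sum_kc ev q (A (inl (s, t)) kc) * u kc.1 kc.2 = dot q u s t.
    move=> ok; rewrite -sum_edge_row; apply: eq_bigr => kc _; rewrite /A ok.
    by rewrite /edge_row rmorphM !rmorphB /= !ev_var !rmorph_nat.
  have evr i : i \in pins W a b ->
      \sum_kc ev q (A (inr i) kc) * u kc.1 kc.2 = u i.1 i.2.
    move=> ip; rewrite (bigD1 i) //= ip eqxx rmorph1 mul1r big1 ?addr0 //.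
    by move=> kc /negPf ->; rewrite rmorph0 mul0r.
  split=> [h|[fu pu] [[s t]|i]].
  - split=> [s t sW tW est|i ip]; last by rewrite -evr.
    by rewrite -evl ?sW ?tW.
  - have [ok|no] := boolP [&& s \in W, t \in W & e s t].
      by rewrite evl //; case/and3P: ok => sW tW est; exact: fu.
    by apply: big1 => kc _; rewrite /= (negPf no) rmorph0 mul0r.
  have [ip|no] := boolP (i \in pins W a b); first by rewrite evr ?pu.
  by apply: big1 => kc _; rewrite /= (negPf no) rmorph0 mul0r.
move=> u fu pu k c.
have := @system_specialization R _ _ _ A (coord p0) (coord p) gp _
  (fun kc => u kc.1 kc.2) _ (k, c).
apply; last by apply/evA.
move=> u0 h0 [l d].
have h0' i : \sum_kc ev p0 (A i kc) * u0 (kc.1, kc.2) = 0.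
  by rewrite -[RHS](h0 i); apply: eq_bigr => -[].
have [f0 z0] := (evA p0 (fun k c => u0 (k, c))).1 h0'.
exact: (pr0 (fun k c => u0 (k, c)) f0 z0 l d).
Qed.

Lemma rigid_complete W e p : generic_config p -> (1 < #|W|)%N ->
  {in W &, forall s t, s != t -> e s t} -> rigid W e p.
Proof.
move=> gp /card_gt1P[a [b [aW bW ab]]] eW.
have xab := generic_coord_neq false gp ab.
apply: (rigid_of_pinned aW bW) => // u fu pin.
have pz l d : (l, d) \in pins W a b -> u l d = 0 by move/pin.
have ua d : u a d = 0 by apply: pz; rewrite inE /= eqxx orbT.
have ub : u b true = 0 by apply: pz; rewrite inE /= eqxx /= !orbT.
have ub' : u b false = 0.
  apply: (mulfI xab); have := fu a b aW bW (eW _ _ aW bW ab).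
  by rewrite /dot !ua ub; lra.
move=> k c; have [kW|kW] := boolP (k \in W); last by apply: pz; rewrite inE /= kW.
have [->|ka] := eqVneq k a; first exact: ua.
have [->|kb] := eqVneq k b; first by case: c.
have f1 := fu k a kW aW (eW _ _ kW aW ka).
have f2 := fu k b kW bW (eW _ _ kW bW kb).
have ar := generic_area gp ka ab kb.
move: f1 f2; rewrite /dot !ua ub ub' !subr0 => f1 f2.
have [|h1 h2] := linear_system2 _ f1 f2; last by case: c.
by apply: contra_neq ar; rewrite /area => h; rewrite -[RHS]h; ring.
Qed.

Lemma flexS W W' e e' p u : W' \subset W -> {in W' &, forall s t, e' s t -> e s t} ->
  flex W e p u -> flex W' e' p u.
Proof.
move=> /subsetP WW ee fu s t sW tW /(ee _ _ sW tW); exact: fu (WW _ sW) (WW _ tW).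
Qed.

Lemma rigid_edgeS W e e' p : {in W &, forall s t, e s t -> e' s t} ->
  rigid W e p -> rigid W e' p.
Proof. by move=> ee rW u fu; apply: rW; apply: flexS ee fu. Qed.

Lemma trivial_motion_extend W p u v a b : trivial_motion (W :\ v) p u ->
  a \in W :\ v -> b \in W :\ v -> area p v a b != 0 ->
  dot p u v a = 0 -> dot p u v b = 0 -> trivial_motion W p u.
Proof.
move=> [w [x [y h]]] aW bW ar da db; exists w, x, y => k kW.
have [->|kv] := eqVneq k v; last by apply: h; rewrite !inE kv.
have [a1 a2] := h a aW; have [b1 b2] := h b bW.
pose d1 := u v false - (x - w * p v true); pose d2 := u v true - (y + w * p v false).
have ea : (p v false - p a false) * d1 + (p v true - p a true) * d2 = 0.
  by rewrite -da /dot a1 a2 /d1 /d2; ring.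
have eb : (p v false - p b false) * d1 + (p v true - p b true) * d2 = 0.
  by rewrite -db /dot b1 b2 /d1 /d2; ring.
have [|e1 e2] := linear_system2 _ ea eb; last by move: e1 e2; rewrite /d1 /d2; split; lra.
by apply: contra_neq ar; rewrite /area => h0; rewrite -[RHS]h0; ring.
Qed.

Lemma flex_adj W (B : {set T * T}) p u s t :
  flex W (fun s t => (s, t) \in B) p u -> s \in W -> t \in W -> adj B s t ->
  dot p u s t = 0.
Proof.
by move=> fu sW tW /orP[] h; [|rewrite dot_sym]; apply: fu.
Qed.

(* Laman's theorem.  In the second Henneberg step the new vertex is first put on the
   midpoint of the deleted edge, where rigidity is clear, and then moved to its
   generic position by semicontinuity of the rank. *)
Lemma rigid_sparse_tight p B W : generic_config p -> sparse B ->
  B \subset setX W W -> tight B W -> rigid W (fun s t => (s, t) \in B) p.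
Proof.
move=> gp; move: {2}#|W| (leqnn #|W|) => n; elim: n B W => [|n IH] B W.
  by rewrite leqn0 /tight => /eqP ->.
move=> Wn sB BW tW; have [W2|W2] := leqP #|W| 2.
  have /andP[W1 tB] := tW.
  have WE : #|W| == 2 by rewrite eqn_leq W2.
  have /cards2P[a [b [ab eW]]] := WE; subst W.
  have ind0 : (0 < #|induced B [set a; b]|)%N.
    by move: tB; rewrite cards2 ab; card_lia.
  move=> u fu; apply: (@rigid_complete [set a; b] (fun s t => s != t)) => //.
  have abB : adj B a b.
    case/card_gt0P: ind0 => -[s t]; rewrite in_induced !inE /= => /and3P[stB].
    have := sparse_edge_neq sB stB; rewrite /adj.
    move=> st /orP[]/eqP es /orP[]/eqP et; move: st stB; rewrite es et ?eqxx //.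
      by move=> _ ->.
    by move=> _ ->; rewrite orbT.
  have dab := flex_adj fu (set21 _ _) (set22 _ _) abB.
  move=> s t; rewrite !inE => /orP[]/eqP-> /orP[]/eqP->; rewrite ?eqxx //.
  by rewrite dot_sym.
have cW v : v \in W -> (#|W :\ v| <= n)%N.
  by move=> vW; move: Wn; rewrite (cardsD1 v) vW.
have sub0 v : induced B (W :\ v) \subset setX (W :\ v) (W :\ v).
  by apply/subsetP => -[s t]; rewrite in_induced in_setX => /andP[].
have [v vW [[a [b [[aW bW ab va vb] tWv]]]|]] := henneberg sB BW tW W2.
  have sBv : sparse (induced B (W :\ v)).
    by apply: sparseS sB; apply/subsetP => f; rewrite inE => /andP[].
  have tBv : tight (induced B (W :\ v)) (W :\ v).
    by rewrite /tight (induced_id (sub0 v)).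
  have rWv := IH _ _ (cW v vW) sBv (sub0 v) tBv.
  move: (aW) (bW); rewrite !inE => /andP[av aW'] /andP[bv bW'].
  move=> u fu; apply: (@trivial_motion_extend _ _ _ v a b) => //.
  - apply: rWv; apply: flexS fu; first exact: subD1set.
    by move=> s t _ _; rewrite inE => /andP[].
  - by apply: generic_area => //; rewrite eq_sym.
  - exact: flex_adj fu vW aW' va.
  - exact: flex_adj fu vW bW' vb.
move=> [a [b [c [[aW bW cW'] [[ab ac bc] [[va vb vc] [sB' tB']]]]]]].
move: (aW) (bW) (cW'); rewrite !inE => /andP[av aW'] /andP[bv bW'] /andP[cv cW''].
have xab := generic_coord_neq false gp ab.
apply: (rigid_of_pinned aW' bW') => //.
pose p0 k d := if k == v then (p a d + p b d) / 2 else p k d.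
apply: (@pinned_specialization _ _ _ p0) => // u fu pin.
have pz l d : (l, d) \in pins W a b -> u l d = 0 by move/pin.
have ua d : u a d = 0 by apply: pz; rewrite inE /= eqxx orbT.
have ub : u b true = 0 by apply: pz; rewrite inE /= eqxx /= !orbT.
have fa := flex_adj fu vW aW' va; have fb := flex_adj fu vW bW' vb.
have fc := flex_adj fu vW cW'' vc.
have uWv : {in W :\ v, forall k d, u k d = 0}.
  apply: (trivial_motion_zero _ aW bW xab) => //.
  apply: (IH _ _ (cW v vW) sB') => //; first by rewrite subUset sub1set in_setX aW bW sub0.
  move=> s t sW tW'; rewrite in_setU1 => /orP[/eqP[-> ->]|].
    (* With [v] at the midpoint of [a] and [b], the equations of the edges from [v] to [a] and to
       [b] add up to that of the edge [a]-[b]. *)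
    move: fa fb; rewrite /dot /p0 eqxx (negPf av) (negPf bv) => fa fb; lra.
  rewrite in_induced => /and3P[stB _ _].
  move: sW tW'; rewrite !inE => /andP[sv sW] /andP[tv tW'].
  by rewrite -(fu s t sW tW' stB) /dot /p0 (negPf sv) (negPf tv).
move=> k d; have [kW|kW] := boolP (k \in W); last by apply: pz; rewrite inE /= kW.
have [->|kv] := eqVneq k v; last by apply: uWv; rewrite !inE kv.
move: fa fc; rewrite /dot /p0 eqxx (negPf av) (negPf cv) !(uWv _ cW') !(uWv _ aW) !subr0.
move=> fa fc; have [|u1 u2] := linear_system2 _ fa fc; last by case: d.
(* The direction from [v] to [a] is parallel to [a]-[b], so noncollinearity of [a], [b], [c] makes
   the two equations independent. *)
have := generic_area gp ab bc ac; apply: contra_neq; rewrite /area => h0.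
apply: (mulfI (_ : - (2^-1 : R) != 0)); first by rewrite oppr_eq0 invr_eq0 pnatr_eq0.
by rewrite mulr0 -[RHS]h0; field.
Qed.

Lemma rigid_or_cover p W e : generic_config p -> (1 < #|W|)%N ->
  rigid W e p \/ exists XX, cover_below W e XX.
Proof.
move=> gp W1; case: (sparse_basis_or_cover e W1) => [[B [BW Be sB tB]]|]; last by right.
left; apply: rigid_edgeS (rigid_sparse_tight gp sB BW tB) => s t _ _ /Be //.
Qed.
End Rigidity.

(** * Stresses shared by equivalent configurations *)

Lemma mnm_subrr n (k : 'X_{1..n}) : (k - k = 0)%MM.
Proof. by apply/mnmP => l; rewrite mnmBE mnm0E subnn. Qed.

(** Chain rule. Both sides are additive and obey the product rule, so constants and variables
    suffice. *)
Lemma mderiv_rmorphism (m n : nat) (phi : {rmorphism {mpoly rat[m]} -> {mpoly rat[n]}})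
    (g : {mpoly rat[m]}) i : (forall c, phi c%:MP = c%:MP) ->
  (phi g)^`M(i) = \sum_j phi g^`M(j) * (phi 'X_j)^`M(i).
Proof.
move=> phiC; pose P g := (phi g)^`M(i) = \sum_j phi g^`M(j) * (phi 'X_j)^`M(i).
have PC c : P c%:MP.
  rewrite /P phiC mderivC big1 // => j _.
  by rewrite mderivC rmorph0 mul0r.
have PD g1 g2 : P g1 -> P g2 -> P (g1 + g2).
  rewrite /P => h1 h2; rewrite rmorphD mderivD h1 h2 -big_split /=.
  by apply: eq_bigr => j _; rewrite mderivD rmorphD mulrDl.
have PM g1 g2 : P g1 -> P g2 -> P (g1 * g2).
  rewrite /P => h1 h2; rewrite rmorphM mderivM h1 h2.
  rewrite big_distrl big_distrr -big_split /=; apply: eq_bigr => j _.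
  rewrite mderivM rmorphD !rmorphM mulrDl; congr (_ + _); last by rewrite mulrA.
  by rewrite mulrAC.
have PX k : P 'X_k.
  rewrite /P (bigD1 k) //= big1 ?addr0 => [|j jk].
    rewrite mderivX mnm1E eqxx scale1r.
    by rewrite mnm_subrr mpolyX0 rmorph1 mul1r.
  by rewrite mderivX mnm1E eq_sym (negPf jk) scale0r rmorph0 mul0r.
have PXm k : P 'X_[k].
  rewrite mpolyXE_id; elim/big_rec: _ => [|l h _ Ph].
    by rewrite -mpolyC1.
  apply: (PM) => //; elim: (k l) => [|d IHd]; first by rewrite expr0 -mpolyC1.
  by rewrite exprS; apply: (PM).
elim/mpolyind: g => [|c k g _ _ Pg]; first by have := PC 0; rewrite /P mpolyC0.
by rewrite -mul_mpolyC; apply: PD => //; apply: PM.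
Qed.

Lemma mmap_comp (R : realType) (m n : nat) (h : 'I_n -> R)
    (F : 'I_m -> {mpoly rat[n]}) (g : {mpoly rat[m]}) :
  mmap (ratr : rat -> R) h (mmap (@mpolyC n rat) F g) =
  mmap ratr (fun j => mmap ratr h (F j)) g.
Proof.
rewrite {2 3}/mmap rmorph_sum; apply: eq_bigr => k _.
rewrite rmorphM /= mmapC rmorph_prod; congr (_ * _).
by apply: eq_bigr => j _; rewrite rmorphXn.
Qed.

(** Descent on the size: when the whole gradient of [g] vanishes at [y], some nonzero partial
    derivative is a smaller relation. Only a constant has all partial derivatives zero, and a
    nonzero constant does not vanish at [y]. *)
Lemma nonsingular_relation (R : realType) (m : nat) (y : 'I_m -> R)
    (g : {mpoly rat[m]}) : g != 0 -> mmap (ratr : rat -> R) y g = 0 ->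
  exists (g' : {mpoly rat[m]}) j,
    mmap (ratr : rat -> R) y g' = 0 /\ mmap (ratr : rat -> R) y g'^`M(j) != 0.
Proof.
move: {2}(msize g) (leqnn (msize g)) => n; elim: n g => [|n IH] g gn g0 yg.
  by move: gn; rewrite leqn0 msize_poly_eq0 (negPf g0).
have [/existsP[j yj]|] := boolP [exists j, mmap (ratr : rat -> R) y g^`M(j) != 0].
  by exists g, j.
rewrite negb_exists => /forallP dy.
have coefD j k : (g^`M(j))@_k = g@_(k + U_(j)) *+ (k j).+1 by rewrite mcoeff_deriv.
have [/existsP[j dj]|] := boolP [exists j, g^`M(j) != 0].
  apply: (IH g^`M(j)) => //; last by have := dy j; rewrite negbK => /eqP.
  rewrite msizeE; apply/bigmax_leqP_seq => k.
  rewrite mcoeff_msupp coefD => kg _.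
  have /msize_mdeg_lt : (k + U_(j))%MM \in msupp g.
    by rewrite mcoeff_msupp; apply: contra kg => /eqP ->; rewrite mul0rn.
  by rewrite mdegD mdeg1 addn1 => lt; rewrite -ltnS (leq_trans lt).
rewrite negb_exists => /forallP d0.
have gC : g = (g@_0)%:MP.
  apply/mpolyP => k; rewrite mcoeffC; have [->|k0] := eqVneq k 0%MM.
    by rewrite mulr1.
  rewrite mulr0; have [j kj] : exists j, k j != 0%N.
    apply/existsP; apply: contraNT k0; rewrite negb_exists => /forallP k0.
    by apply/eqP/mnmP => j; rewrite mnm0E; apply/eqP; have := k0 j; rewrite negbK.
  have := d0 j; rewrite negbK => /eqP/(congr1 (mcoeff (k - U_(j)))).
  rewrite coefD mcoeff0 submK; last by rewrite lep1mP.
  by move/eqP; rewrite mulrn_eq0 => /eqP.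
move: g0 yg; rewrite gC mmapC => g0 /eqP; rewrite fmorph_eq0 => /eqP e0.
by rewrite e0 mpolyC0 eqxx in g0.
Qed.

Section Stress.
Variables (R : realType) (N : nat).
Local Notation T := 'I_N.
Local Notation config := (T -> bool -> R).
Implicit Types (p q u : config) (e : rel T) (W : {set T}).

Lemma mderiv_var (k s : T) (c d : bool) :
  (var s d)^`M(mxvec_index k (if c then 1 else 0)) = ((k == s) && (c == d))%:R.
Proof.
rewrite /var mderivX mnm1E.
have -> : (mxvec_index s (if d then 1 else 0) ==
    mxvec_index k (if c then 1 else 0 : 'I_2)) = (k == s) && (c == d).
  have inj : injective (uncurry (@mxvec_index N 2)).
    have [g gK _] := curry_mxvec_bij N 2 => x y eqxy.
    by rewrite -(gK x) ?inE // -(gK y) ?inE // eqxy.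
  apply/eqP/andP => [|[/eqP-> /eqP->]//].
  move/(inj (s, _) (k, _)) => [-> e]; split=> //.
  by move: e; case: (c); case: (d).
have [/andP[/eqP-> /eqP->]|_] := boolP (_ && _); last by rewrite scale0r.
rewrite scale1r.
by rewrite mnm_subrr mpolyX0.
Qed.

Definition sqdist_poly (st : T * T) : {mpoly rat[N * 2]} :=
  (var st.1 false - var st.2 false) ^+ 2 + (var st.1 true - var st.2 true) ^+ 2.

Lemma ev_sqdist_poly p st : ev p (sqdist_poly st) = dot p p st.1 st.2.
Proof.
by rewrite /sqdist_poly rmorphD !rmorphXn !rmorphB /= !ev_var /dot !expr2.
Qed.

Lemma ev_mderiv_sqdist p st kc :
  ev p (sqdist_poly st)^`M(mxvec_index kc.1 (if kc.2 then 1 else 0)) =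
  2 * edge_row p st.1 st.2 kc.
Proof.
case: kc => k c /=.
rewrite /sqdist_poly mderivD !expr2 !mderivM !mderivB !mderiv_var.
rewrite !(rmorphD, rmorphM, rmorphN) /= !ev_var !rmorph_nat /edge_row /=.
by case: c => /=; rewrite ?andbT ?andbF; ring.
Qed.

(** The relation composed with the squared lengths vanishes at the generic [p], hence identically,
    so its derivatives vanish at [q] too. The gradient of the relation depends only on the shared
    lengths, so the chain rule gives the same coefficients for [p] and [q]. *)
Lemma inherited_stress p q m (L : 'I_m -> T * T) : generic_config p ->
  (exists2 g : {mpoly rat[m]}, g != 0 &
     mmap (ratr : rat -> R) (fun j => dot p p (L j).1 (L j).2) g = 0) ->
  (forall j, dot q q (L j).1 (L j).2 = dot p p (L j).1 (L j).2) ->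
  exists c : 'I_m -> R, (exists j, c j != 0) /\ forall kc,
    \sum_j c j * edge_row p (L j).1 (L j).2 kc = 0 /\
    \sum_j c j * edge_row q (L j).1 (L j).2 kc = 0.
Proof.
move=> gp [g0 g0n g0y] eqL; set y := fun j => _ in g0y.
have [g [j0 [gy gj0]]] := nonsingular_relation g0n g0y.
exists (fun j => mmap (ratr : rat -> R) y g^`M(j)); split; first by exists j0.
pose F j := sqdist_poly (L j).
have evF x h : (forall j, dot x x (L j).1 (L j).2 = y j) ->
    ev x (mmap (@mpolyC _ rat) F h) = mmap (ratr : rat -> R) y h.
  move=> xy; rewrite /ev mmap_comp; apply: eq_bigr => k _; congr (_ * _).
  by apply: eq_bigr => j _; rewrite -/(ev x _) ev_sqdist_poly xy.
have G0 : mmap (@mpolyC _ rat) F g = 0.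
  by apply/eqP; apply: contraTT isT => /gp; rewrite evF // gy eqxx.
have stress x kc : (forall j, dot x x (L j).1 (L j).2 = y j) ->
    \sum_j mmap (ratr : rat -> R) y g^`M(j) * edge_row x (L j).1 (L j).2 kc = 0.
  move=> xy; pose i := mxvec_index kc.1 (if kc.2 then 1 else 0 : 'I_2).
  have d0 : (mmap (@mpolyC _ rat) F g)^`M(i) = 0 by rewrite G0 mderiv0.
  have /(congr1 (ev x)) := etrans (esym d0)
    (@mderiv_rmorphism _ _ (mmap (@mpolyC _ rat) F) g i (mmapC _ _)).
  rewrite rmorph0 rmorph_sum /= => e0.
  have two : (2 : R) != 0 by rewrite pnatr_eq0.
  apply: (mulfI two); rewrite mulr0 [RHS]e0 mulr_sumr.
  apply: eq_bigr => j _; rewrite rmorphM /= evF // mmapX mmap1U.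
  by rewrite ev_mderiv_sqdist; ring.
by move=> kc; split; apply: stress.
Qed.

(** After an isometry the points of [W] depend on the unpinned coordinates only, so the [m] squared
    distances are polynomials in fewer than [m] variables. *)
Lemma distance_relation p W a b m (L : 'I_m -> T * T) : generic_config p ->
  a != b -> (#|~: pins W a b| < m)%N ->
  (forall j, (L j).1 \in W /\ (L j).2 \in W) ->
  exists2 g : {mpoly rat[m]}, g != 0 &
     mmap (ratr : rat -> R) (fun j => dot p p (L j).1 (L j).2) g = 0.
Proof.
move=> gp ab lt_m LW; set I := ~: pins W a b in lt_m *.
pose X (k : T) (c : bool) : {mpoly rat[#|I|]} :=
  if @idP ((k, c) \in I) is ReflectT kcI then 'X_(enum_rank_in kcI (k, c)) else 0.
pose F j := (X (L j).1 false - X (L j).2 false) ^+ 2 +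
            (X (L j).1 true - X (L j).2 true) ^+ 2.
have [g g0 gF] := algebraic_dependence F lt_m; exists g => //.
(* Move p by the isometry that sends a to the origin and b to the first axis. *)
pose x := p b false - p a false; pose y := p b true - p a true.
have n_gt0 : 0 < x ^+ 2 + y ^+ 2.
  rewrite ltr_pwDl ?sqr_ge0 // exprn_even_gt0 //=.
  by rewrite generic_coord_neq // eq_sym.
pose n := Num.sqrt (x ^+ 2 + y ^+ 2).
have n0 : n != 0 by rewrite gt_eqF // sqrtr_gt0.
have n2 : n ^+ 2 = x ^+ 2 + y ^+ 2 by rewrite sqr_sqrtr // ltW.
pose z (k : T) (c : bool) :=
  if c then (x * (p k true - p a true) - y * (p k false - p a false)) / n
  else (x * (p k false - p a false) + y * (p k true - p a true)) / n.
have zdist s t : (z s false - z t false) ^+ 2 + (z s true - z t true) ^+ 2 = dot p p s t.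
  apply: (mulIf (expf_neq0 2 n0)); rewrite /z {2}n2 /dot.
  by field.
pose h (i : 'I_#|I|) : R := z (enum_val i).1 (enum_val i).2.
have evX k c : k \in W -> mmap (ratr : rat -> R) h (X k c) = z k c.
  move=> kW; rewrite /X; case: {-}_ / idP => [kcI|].
    by rewrite mmapX mmap1U /h enum_rankK_in.
  move/negP; rewrite !inE negbK kW /= rmorph0 => /orP[/eqP->|/andP[/eqP-> ->]].
    by rewrite /z !subrr !mulr0 addr0 subr0 mul0r; case: c.
  by rewrite /z /= -/x -/y [y * x]mulrC subrr mul0r.
have := congr1 (mmap (ratr : rat -> R) h) gF; rewrite mmap_comp rmorph0 => e0.
rewrite -[RHS]e0.
apply: eq_bigr => k _; congr (_ * _); apply: eq_bigr => j _; congr (_ ^+ _).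
have [L1 L2] := LW j.
by rewrite /F rmorphD !rmorphXn !rmorphB /= !evX // zdist.
Qed.

(* The relation between the squared distances of an independent set of edges and of
   v-a, v-b, v-c yields a stress shared by p and q, whose equilibrium at v determines
   the angles at v. *)
Lemma star_distance p q W e v a b c : generic_config p -> rigid W e p ->
  v \notin W -> a \in W -> b \in W -> c \in W ->
  a != b -> b != c -> a != c ->
  {in W &, forall s t, e s t -> dot q q s t = dot p p s t} ->
  dot q q v a = dot p p v a -> dot q q v b = dot p p v b ->
  dot q q v c = dot p p v c -> dot q q a b = dot p p a b.
Proof.
move=> gp rW vW aW bW cW ab bc ac eqe eqa eqb eqc.
have neqv x : x \in W -> (v == x) = false.
  by move=> xW; apply: contraNF vW => /eqP ->.
have xab := generic_coord_neq false gp ab.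
have pr := rigid_pinned aW bW xab rW.
pose act (st : T * T) := [&& st.1 \in W, st.2 \in W & e st.1 st.2].
pose A (st : T * T) kc := if act st then edge_row p st.1 st.2 kc else 0.
(* Rigidity of [W] supplies independent edges, at least as many as the unpinned coordinates of
   [W]. *)
have [u fu pu|r [f [rD indep]]] := @independent_rows _ _ _ A (pins W a b).
  move=> [k d]; apply: (pr (fun k d => u (k, d))) => [s t sW tW est|[l l'] /pu //].
  have := fu (s, t); rewrite /A /act /= sW tW est /= => e0.
  rewrite -sum_edge_row -[RHS]e0; apply: eq_bigr => -[] //.
have fact i : act (f i).
  apply: contraT => nact; suff : (1 : R) = 0 by move/eqP; rewrite oner_eq0.
  have := indep (fun j => (j == i)%:R); move=> /(_ _ i); rewrite eqxx; apply => kc.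
  rewrite (bigD1 i) //= big1 ?addr0 => [|j /negPf->]; last by rewrite mul0r.
  by rewrite /A (negPf nact) mulr0.
pose w (k : 'I_3) := tnth [tuple a; b; c] k.
pose L (j : 'I_(r + 3)) := match split j with inl i => f i | inr k => (v, w k) end.
have Ll i : L (lshift 3 i) = f i 
  by rewrite /L -[lshift 3 i]/(unsplit (inl i)) unsplitK.
have Lr k : L (rshift r k) = (v, w k).
  by rewrite /L -[rshift r k]/(unsplit (inr k)) unsplitK.
have wW k : w k \in W.
  by case: k => [[|[|[|]]]] //= lt; rewrite /w (tnth_nth a).
pose W' := v |: W.
have LW j : (L j).1 \in W' /\ (L j).2 \in W'.
  rewrite /L; case: (split j) => [i|k] /=; last by rewrite !inE eqxx wW orbT.
  by have /and3P[h1 h2 _] := fact i; rewrite !inE h1 h2 !orbT.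
(* [v] brings two coordinates but three edges, so there are more lengths than coordinates. *)
have card_lt : (#|~: pins W' a b| < r + 3)%N.
  have : (#|~: pins W' a b| <= #|~: pins W a b| + 2)%N.
    have sub : ~: pins W' a b \subset ~: pins W a b :|: [set (v, false); (v, true)].
      apply/subsetP => -[k d]; rewrite !inE -!pair_eqE /=.
      by case: (k == v); case: d; rewrite /= ?orbT ?orbF.
    apply: (leq_trans (subset_leq_card sub)); apply: (leq_trans (leq_card_setU _ _)).
    by rewrite leq_add2l cards2; case: eqP.
  by move: rD; card_lia.
have dep := distance_relation gp ab card_lt LW.
have eqL j : dot q q (L j).1 (L j).2 = dot p p (L j).1 (L j).2.
  rewrite /L; case: (split j) => [i|k] /=.
    by have /and3P[h1 h2 h3] := fact i; apply: eqe.
  by case: k => [[|[|[|]]]] //= lt; rewrite /w (tnth_nth a).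
have [l [[j0 lj0] stress]] := inherited_stress gp dep eqL.
have rowf x i d : edge_row x (f i).1 (f i).2 (v, d) = 0.
  have /and3P[h1 h2 _] := fact i.
  by rewrite /edge_row /= (neqv _ h1) (neqv _ h2) subrr mulr0.
have roww x k d : edge_row x v (w k) (v, d) = x v d - x (w k) d.
  by rewrite /edge_row /= eqxx (neqv _ (wW k)) subr0 mulr1.
pose la := l (rshift r ord0); pose lb := l (rshift r (inord 1)).
pose lc := l (rshift r (inord 2)).
have sum3 (G : 'I_3 -> R) : \sum_k G k = G ord0 + G (inord 1) + G (inord 2).
  rewrite !big_ord_recl big_ord0 addr0 addrA; congr (G _ + G _ + G _).
    by apply: val_inj; rewrite /= inordK.
  by apply: val_inj; rewrite /= inordK.
have eqv x d : \sum_j l j * edge_row x (L j).1 (L j).2 (v, d) =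
   la * (x v d - x a d) + lb * (x v d - x b d) + lc * (x v d - x c d).
  rewrite big_split_ord /= big1 ?add0r => [|i _]; last by rewrite Ll rowf mulr0.
  rewrite sum3 !Lr /= !roww /w !(tnth_nth a) /= !inordK //.
have eqp d : la * (p v d - p a d) + lb * (p v d - p b d) + lc * (p v d - p c d) = 0.
  by rewrite -eqv; have [] := stress (v, d).
have eqq d : la * (q v d - q a d) + lb * (q v d - q b d) + lc * (q v d - q c d) = 0.
  by rewrite -eqv; have [] := stress (v, d).
have va : v != a by rewrite neqv.
have vb : v != b by rewrite neqv.
have vc : v != c by rewrite neqv.
have not_all0 : la = 0 -> lb = 0 -> lc = 0 -> False.
  move=> la0 lb0 lc0.
  have l3 k : l (rshift r k) = 0.
    case: k => [[|[|[|]]]] //= lt.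
    - by rewrite -[RHS]la0; congr (l (rshift r _)); apply: val_inj.
    - by rewrite -[RHS]lb0; congr (l (rshift r _)); apply: val_inj; rewrite /= inordK.
    - by rewrite -[RHS]lc0; congr (l (rshift r _)); apply: val_inj; rewrite /= inordK.
  have lf i : l (lshift 3 i) = 0.
    apply: (indep (fun i => l (lshift 3 i))) => kc.
    have [] := stress kc; rewrite big_split_ord /= [X in _ + X]big1 ?addr0 => [e0 _|k _].
      by rewrite -[RHS]e0; apply: eq_bigr => i' _; rewrite Ll /A fact.
    by rewrite l3 mul0r.
  by case/eqP: lj0; case: (split_ordP j0) => i ->.
have ex := eqp false; have ey := eqp true.
have la0 : la != 0.
  apply/eqP => la0; move: ex ey.
  rewrite la0 !mul0r !add0r ![lb * _]mulrC ![lc * _]mulrC => ex ey.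
  have [|lb0 lc0] := linear_system2 _ ex ey; last exact: not_all0.
  have := generic_area gp vb bc vc; apply: contra_neq => h0.
  by rewrite /area -[RHS]h0; ring.
have lb0 : lb != 0.
  apply/eqP => lb0; move: ex ey.
  rewrite lb0 !mul0r !addr0 ![la * _]mulrC ![lc * _]mulrC => ex ey.
  have [|la0' lc0] := linear_system2 _ ex ey; last exact: not_all0.
  have := generic_area gp va ac vc; apply: contra_neq => h0.
  by rewrite /area -[RHS]h0; ring.
(* Isolating the term of [c] in the equilibrium at [v] and squaring expresses the inner product of
   the vectors to [a] and [b], hence the length of [a]-[b], through the lengths at [v]. *)
have lc2 x : (forall d, la * (x v d - x a d) + lb * (x v d - x b d) +
      lc * (x v d - x c d) = 0) ->
    la * lb * dot x x a b = la * (la + lb) * dot x x v a +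
      lb * (la + lb) * dot x x v b - lc ^+ 2 * dot x x v c.
  move=> eqx; have cx d : lc * (x v d - x c d) =
      - (la * (x v d - x a d) + lb * (x v d - x b d)).
    by have := eqx d; lra.
  have -> : lc ^+ 2 * dot x x v c = (lc * (x v false - x c false)) ^+ 2 +
     (lc * (x v true - x c true)) ^+ 2 by rewrite /dot; ring.
  by rewrite !cx /dot; ring.
apply: (mulfI (mulf_neq0 la0 lb0)).
by rewrite (lc2 q) // (lc2 p) // eqa eqb eqc.
Qed.
End Stress.

(** * Connectivity and private edges *)

Section Connectivity.
Local Open Scope nat_scope.
Variable T : finType.
Implicit Types (W A C K S X Y Bd : {set T}) (e : rel T) (XX : {set {set T}}).

(* Unlike [k_connected], [kcon] does not require #|W| > k. *)
Definition kcon k W e := [forall A : {set T}, forall C : {set T},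
  [&& A \subset W, [disjoint A & C], #|C| < k, A != set0 & W :\: (A :|: C) != set0]
  ==> [exists a in A, exists b in W :\: (A :|: C), e a b]].

Lemma kconP k W e : reflect (forall A C, A \subset W -> [disjoint A & C] ->
    #|C| < k -> A != set0 -> W :\: (A :|: C) != set0 ->
    exists a b, [/\ a \in A, b \in W, b \notin A, b \notin C & e a b]) (kcon k W e).
Proof.
apply: (iffP forallP) => [h A C AW dAC Ck A0 B0|h A].
  have /forallP/(_ C) := h A; rewrite AW dAC Ck A0 B0 /=.
  move=> /exists_inP[a aA /exists_inP[b bB eab]]; exists a, b.
  by move: bB; rewrite !inE negb_or => /andP[/andP[-> ->] ->].
apply/forallP => C; apply/implyP => /and5P[AW dAC Ck A0 B0].
have [a [b [aA bW bA bC eab]]] := h A C AW dAC Ck A0 B0.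
apply/exists_inP; exists a => //; apply/exists_inP; exists b => //.
by rewrite !inE negb_or bA bC bW.
Qed.

Definition nbrs e v := [set x | e v x].

Definition good W e := [/\ ssrbool.symmetric e, irreflexive e, forall s t, e s t -> s \in W,
  forall s t, e s t -> exists r, e s r && e t r & kcon 3 W e].

(** Otherwise the neighbourhood of [v] would be a small set separating [v] from the remaining
    vertices. *)
Lemma kcon_degree k W e v : (forall s t, e s t -> t \in W) -> kcon k W e ->
  v \in W -> e v v = false -> k < #|W| -> k <= #|nbrs e v|.
Proof.
move=> eW /kconP kW vW evv kltW; rewrite leqNgt; apply/negP => small.
have dv : [disjoint [set v] & nbrs e v] by rewrite disjoints1 inE evv.
have [|||a [b]] := kW [set v] (nbrs e v) _ dv small.
- by rewrite sub1set.
- by apply/set0Pn; exists v; rewrite inE.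
- rewrite -card_gt0; have := cardsDS (_ : [set v] :|: nbrs e v \subset W) => -> //.
    have : #|[set v] :|: nbrs e v| <= 1 + #|nbrs e v|.
      by rewrite -(cards1 v) leq_card_setU.
    by move: kltW small; card_lia.
  by rewrite subUset sub1set vW; apply/subsetP => x; rewrite inE => /eW.
by rewrite inE => -[/eqP-> _ _]; rewrite inE => /negP.
Qed.

Lemma good_memr W e s t : good W e -> e s t -> t \in W.
Proof. by move=> [sym _ eW _ _]; rewrite sym => /eW. Qed.

Lemma good_degree W e v : good W e -> v \in W -> 3 < #|W| -> 2 < #|nbrs e v|.
Proof.
move=> gW vW W3; have [_ irr _ _ kW] := gW.
by apply: (kcon_degree (W := W)) => // s t; apply: good_memr gW.
Qed.

(** * Counting incidences in covers *)

Definition mult XX x := #|[set X in XX | x \in X]|.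

Lemma sum_mult XX S : \sum_(X in XX) #|X :&: S| = \sum_(x in S) mult XX x.
Proof.
transitivity (\sum_(X in XX) \sum_(x in S) (x \in X : nat)).
  apply: eq_bigr => X _; rewrite -sum1_card big_mkcond [RHS]big_mkcond /=.
  by apply: eq_bigr => x _; rewrite inE; case: (x \in X); case: (x \in S).
rewrite exchange_big /=; apply: eq_bigr => x _.
rewrite /mult -sum1_card big_mkcond [RHS]big_mkcond /=.
by apply: eq_bigr => X _; rewrite inE; case: (X \in XX); case: (x \in X).
Qed.

(* Counts incidences between members of the cover and boundary vertices; each
   member needs 3 of them and each boundary vertex x supplies at most
   2 * (mult x - 1), up to the corrections on S and on two-element members. *)
Lemma cover_count W XX Bd S : S \subset W -> Bd \subset W ->
  (forall X, X \in XX -> X \subset W /\ 1 < #|X|) ->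
  (forall X, X \in XX -> 3 <= #|X :&: Bd| + (#|X| == 2)) ->
  (forall x, x \in W -> (x \in Bd) * mult XX x + 2 <= 2 * mult XX x + (x \in S)) ->
  \sum_(X in XX) (2 * #|X| - 3) + 3 < 2 * #|W| ->
  3 < #|S| + #|[set X in XX | #|X| == 2]|.
Proof.
move=> SW BdW XXW bd3 pt lt.
have e1 : \sum_(X in XX) (2 * #|X| - 3) + 3 * #|XX| = 2 * \sum_(x in W) mult XX x.
  rewrite -sum_mult big_distrr /= -sum1_card big_distrr -big_split /=.
  apply: eq_bigr => X /XXW[/setIidPl -> X1]; move: X1; card_lia.
have e2 : 3 * #|XX| <= \sum_(x in Bd) mult XX x + #|[set X in XX | #|X| == 2]|.
  have -> : #|[set X in XX | #|X| == 2]| = \sum_(X in XX) (#|X| == 2 : nat).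
    rewrite -sum1_card big_mkcond [RHS]big_mkcond /=; apply: eq_bigr => X _.
    by rewrite inE; case: (X \in XX); case: eqP.
  rewrite -sum_mult -big_split -sum1_card big_distrr /=; apply: leq_sum => X XX'.
  exact: bd3.
have e3 : \sum_(x in Bd) mult XX x + 2 * #|W| <= 2 * \sum_(x in W) mult XX x + #|S|.
  have -> : \sum_(x in Bd) mult XX x = \sum_(x in W) (x \in Bd) * mult XX x.
    rewrite big_mkcond [RHS]big_mkcond /=; apply: eq_bigr => x _.
    have [/(subsetP BdW) ->|_] := boolP (x \in Bd); first by rewrite mul1n.
    by rewrite mul0n; case: ifP.
  have -> : #|S| = \sum_(x in W) (x \in S).
    rewrite -sum1_card big_mkcond [RHS]big_mkcond /=; apply: eq_bigr => x _.
    have [/(subsetP SW) ->//|_] := boolP (x \in S); by case: ifP.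
  rewrite -sum1_card !big_distrr -!big_split /=; apply: leq_sum => x xW.
  by rewrite muln1; apply: pt.
move: e1 e2 e3 lt; set a := \sum_(X in _) _; set b := \sum_(x in _) _.
set c := \sum_(x in _) _; card_lia.
Qed.

(* [prv e s t]: s and t have at most one common neighbour.
   [pedge e v a b]: the only triangle containing the edge a-b has apex v. *)
Definition prv e s t := [forall z, forall w, [&& e s z, e t z, e s w & e t w] ==> (z == w)].
Definition pedge e v a b := [&& e a b, e v a, e v b & prv e a b].
Definition privs e v := [set X : {set T} |
  [exists a, exists b, (X == [set a; b]) && pedge e v a b]].

Lemma prvP e s t z w : prv e s t -> e s z -> e t z -> e s w -> e t w -> z = w.
Proof.
by move=> /forallP/(_ z)/forallP/(_ w) + h1 h2 h3 h4; rewrite h1 h2 h3 h4 => /eqP.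
Qed.

Lemma prv_sym e s t : prv e s t -> prv e t s.
Proof.
move=> h; apply/forallP => z; apply/forallP => w; apply/implyP => /and4P[h1 h2 h3 h4].
by apply/eqP; apply: (prvP h).
Qed.

Lemma prvNP e s t : ~~ prv e s t ->
  exists z w, [/\ e s z, e t z, e s w, e t w & z != w].
Proof.
rewrite negb_forall => /existsP[z]; rewrite negb_forall => /existsP[w].
by rewrite negb_imply => /andP[/and4P[h1 h2 h3 h4] zw]; exists z, w.
Qed.

(** A triangle at [z] through [x] or [y] must be [z], [x], [y], since [z]-[x] and [z]-[y] lie in no
    other triangle. Any other edge counted at apex [z] joins the at most two remaining
    neighbours. *)
Lemma few_private e x y z : ssrbool.symmetric e -> irreflexive e ->
  e z x -> e z y -> e x y -> prv e z x -> prv e z y -> #|nbrs e z| <= 4 ->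
  #|privs e z| <= 2.
Proof.
move=> sym irr zx zy xy pzx pzy d4.
pose Z := nbrs e z :\: [set x; y].
have cZ : #|Z| <= 2.
  rewrite cardsDS; last by rewrite subUset !sub1set !inE zx.
  rewrite cards2; have -> : x != y by apply: contraTneq xy => ->; rewrite irr.
  by move: d4; card_lia.
have sub : privs e z \subset [set [set x; y]; Z].
  apply/subsetP => X; rewrite inE => /existsP[s /existsP[t /andP[/eqP-> ]]].
  move=> /and4P[st zs zt _].
  have ts : e t s by rewrite sym.
  have yx : e y x by rewrite sym.
  rewrite !inE; have [sx|sx] := eqVneq s x.
    by rewrite -sx (prvP pzx zt _ zy xy) -?sx // sx eqxx.
  have [sy|sy] := eqVneq s y.
    by rewrite -sy setUC (prvP pzy zt _ zx yx) -?sy // sy eqxx.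
  have [tx|tx] := eqVneq t x.
    by rewrite -tx setUC (prvP pzx zs _ zy xy) -?tx // tx eqxx.
  have [ty|ty] := eqVneq t y.
    by rewrite -ty (prvP pzy zs _ zx yx) -?ty // ty eqxx.
  apply/orP; right; rewrite eqEcard cards2.
  have -> /= : s != t by apply: contraTneq st => ->; rewrite irr.
  rewrite cZ andbT; apply/subsetP => r; rewrite !inE => /orP[]/eqP->.
    by rewrite negb_or sx sy zs.
  by rewrite negb_or tx ty zt.
apply: (leq_trans (subset_leq_card sub)); rewrite cards2; by case: eqP.
Qed.

(** When [D] spans a triangle, the removed edges are those of [D] that lie in no other triangle. *)
Definition drop_private e (D : {set T}) : rel T :=
  fun s t => e s t && ~~ [&& s \in D, t \in D & prv e s t].

(** If removal destroys 3-connectivity, some side of the resulting separation meets [D] in one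
    vertex [z]. By 4-connectivity that side is [z] alone, so the neighbours of [z] are the at most
    two separating vertices and the rest of [D], and both edges from [z] within [D] were removed. *)
Lemma private_triangle_removal W e v a b : good W e -> kcon 4 W e -> 4 < #|W| ->
  pedge e v a b -> let D := [set a; b; v] in
  good W (drop_private e D) \/
  exists z x y, [/\ D = [set z; x; y], [/\ e z x, e z y & e x y],
    prv e z x, prv e z y & #|nbrs e z| <= 4].
Proof.
move=> gW k4 W4 /and4P[ab va vb pab] D; have [sym irr eW tri k3] := gW.
have neq s t : e s t -> s != t by move=> h; apply: contraTneq h => ->; rewrite irr.
have cliq s t : s \in D -> t \in D -> s != t -> e s t.
  rewrite !inE -!orbA => /or3P[]/eqP-> /or3P[]/eqP->; rewrite ?eqxx // => _ //;
    by rewrite sym.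
have third s t : s \in D -> t \in D -> s != t ->
    exists r, [/\ r \in D, e s r, e t r & D = [set s; t; r]].
  have sw3 (x y z : T) : [set x; y; z] = [set y; x; z] by rewrite (setUC [set x]).
  have sw3' (x y z : T) : [set x; y; z] = [set x; z; y] by rewrite setUAC.
  rewrite !inE -!orbA => /or3P[]/eqP-> /or3P[]/eqP->; rewrite ?eqxx // => _.
  - by exists v; rewrite !inE eqxx ?orbT; split=> //; rewrite sym.
  - exists b; rewrite !inE eqxx ?orbT; split=> //; by rewrite /D sw3'.
  - by exists v; rewrite !inE eqxx ?orbT; split=> //; rewrite 1?sym //; rewrite /D sw3.
  - by exists a; rewrite !inE eqxx ?orbT; split=> //; rewrite 1?sym //; rewrite /D sw3 sw3'.
  - exists b; rewrite !inE eqxx ?orbT; split=> //; by rewrite /D sw3' sw3.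
  - exists a; rewrite !inE eqxx ?orbT; split=> //; rewrite 1?sym //.
    by rewrite /D sw3 sw3' sw3.
have [/existsP[z /existsP[x /existsP[y /and5P[/eqP h1 h2 h3 h4 h5]]]]|none] :=
  boolP [exists z, exists x, exists y, [&& D == [set z; x; y],
    [&& e z x, e z y & e x y], prv e z x, prv e z y & #|nbrs e z| <= 4]].
  by right; exists z, x, y; case/and3P: h2.
left; pose e' := drop_private e D; rewrite -/e'.
have sub s t : e' s t -> e s t by case/andP.
have diff s t : e s t -> ~~ e' s t -> [/\ s \in D, t \in D & prv e s t].
  by rewrite /e' /drop_private => -> /=; rewrite negbK => /and3P.
have outD s t : e s t -> t \notin D -> e' s t.
  by move=> est tD; rewrite /e' /drop_private est (negPf tD) andbF.
have sym' : ssrbool.symmetric e'.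
  move=> s t; rewrite /e' /drop_private sym; congr (_ && ~~ _).
  by rewrite andbCA; congr [&& _, _ & _]; apply/idP/idP; apply: prv_sym.
have tri' s t : e' s t -> exists r, e' s r && e' t r.
  move=> est'; have est := sub _ _ est'; have [r /andP[esr etr]] := tri s t est.
  (* If a surviving edge [x]-[y] has a triangle that loses [x]-[r], that triangle is [D]. Having
     survived, [x]-[y] lies in a second triangle, whose apex is outside [D] and whose other edges
     are kept. *)
  suff main x y : e' x y -> e x r -> e y r -> ~~ e' x r -> exists r, e' x r && e' y r.
    have [sr|sr] := boolP (e' s r); last exact: main etr sr.
    have [tr|tr] := boolP (e' t r); first by exists r; rewrite sr.
    have [|r' /andP[h1 h2]] := main t s _ etr esr tr; first by rewrite sym'.
    by exists r'; rewrite h1 h2.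
  move=> exy' xr yr nxr; have exy := sub _ _ exy'.
  have [xD rD pxr] := diff _ _ xr nxr.
  have [d [dD xd rd DE]] := third x r xD rD (neq _ _ xr).
  have yd : y = d by apply: (prvP pxr exy _ xd rd); rewrite sym.
  have yD : y \in D by rewrite yd.
  have npxy : ~~ prv e x y by move: exy'; rewrite /e' /drop_private xD yD => /andP[].
  have [z1 [z2 [x1 y1 x2 y2 z12]]] := prvNP npxy.
  have [z [xz yz zr]] : exists z, [/\ e x z, e y z & z != r].
    have [zr|zr] := eqVneq z1 r; last by exists z1.
    by exists z2; split=> //; rewrite -zr eq_sym.
  have zD : z \notin D.
    rewrite DE -yd !inE !negb_or zr eq_sym (neq _ _ xz) eq_sym.
    by rewrite (neq _ _ yz).
  by exists z; rewrite !outD.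
split=> //; first by move=> s; rewrite /e' /drop_private irr.
  by move=> s t /sub/eW.
apply/kconP => A C AW dAC C3 A0 B0.
apply/'exists_'exists_and5P; apply: contraT; rewrite negb_exists => /forallP noE.
have {}noE x y : x \in A -> y \in W -> y \notin A -> y \notin C -> ~~ e' x y.
  move=> xA yW yA yC; have := noE x; rewrite negb_exists => /forallP/(_ y).
  by rewrite xA yW yA yC.
have key (U : {set T}) z : U \subset W -> [disjoint U & C] -> W :\: (U :|: C) != set0 ->
    (forall x y, x \in U -> y \in W -> y \notin U -> y \notin C -> ~~ e' x y) ->
    z \in U -> z \in D -> (forall x, x \in U -> x \in D -> x = z) -> False.
  move=> UW dUC V0 noU zU zD uniqz.
  have zC : z \notin C by rewrite (disjointFr dUC).
  (* Removed edges leaving [U] start at [z]. Hence [C] and [z], at most three vertices, would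
     separate the rest of [U] in the original graph. *)
  have U1 : U = [set z].
    apply/eqP; rewrite eqEsubset sub1set zU andbT -setD_eq0.
    apply: contraT => U0; have /kconP k4' := k4.
    have [|||||x [y]] := k4' (U :\: [set z]) (z |: C) => //.
    - by apply: subset_trans UW; exact: subsetDl.
    - rewrite -setI_eq0; apply/eqP/setP => t; rewrite !inE.
      apply/negP => /andP[/andP[tz tU]]; rewrite (negPf tz) /=.
      by rewrite (disjointFr dUC).
    - by rewrite cardsU1 zC.
    - case/set0Pn: V0 => t tV; apply/set0Pn; exists t; move: tV.
      rewrite !inE !negb_or => /andP[/andP[tU tC] tW].
      have tz : t != z by apply: contraNneq tU => ->.
      by rewrite tW tC (negPf tU) tz.
    rewrite !inE !negb_or => -[/andP[xz xU] yW yU /andP[yz yC] exy].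
    have yU' : y \notin U by move: yU; rewrite yz.
    have [xD _ _] := diff _ _ exy (noU _ _ xU yW yU' yC).
    by rewrite (uniqz x) ?eqxx in xz.
  have [x zx] : exists x, x \in D :\ z.
    have [az|az] := eqVneq a z; last by exists a; rewrite !inE eqxx az.
    by exists b; rewrite !inE -az eq_sym (neq _ _ ab) eqxx orbT.
  move: zx; rewrite in_setD1 => /andP[xz xD].
  rewrite eq_sym in xz; have [y [yD zy xy DE]] := third z x zD xD xz.
  have zx : e z x by apply: cliq.
  have nb_sub : nbrs e z \subset C :|: [set x; y].
    apply/subsetP => t; rewrite inE => zt; rewrite in_setU; apply/orP.
    have [tC|tC] := boolP (t \in C); [by left | right].
    have tU : t \notin U by rewrite U1 inE eq_sym (neq _ _ zt).
    have [_ tD _] := diff _ _ zt (noU _ _ zU (good_memr gW zt) tU tC).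
    by move: tD; rewrite DE !inE -orbA eq_sym (negPf (neq _ _ zt)).
  have zW : z \in W by apply: (subsetP UW).
  have deg4 : 4 <= #|nbrs e z|.
    by apply: (kcon_degree (W := W)) => // s t; apply: good_memr gW.
  have cU := cardsUI C [set x; y]; rewrite cards2 (neq _ _ xy) /= in cU.
  have le := subset_leq_card nb_sub.
  have CI0 : #|C :&: [set x; y]| = 0 by move: cU le deg4 C3; card_lia.
  have notC t : t \in [set x; y] -> t \notin C.
    move=> tx; apply/negP => tC.
    move/eqP: CI0; rewrite cards_eq0 => /eqP/setP/(_ t).
    by rewrite inE tC tx inE.
  have pz t : t \in [set x; y] -> e z t -> prv e z t.
    move=> txy zt; have tU : t \notin U by rewrite U1 inE eq_sym (neq _ _ zt).
    by have [] := diff _ _ zt (noU _ _ zU (good_memr gW zt) tU (notC _ txy)).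
  case/negP: none; apply/existsP; exists z; apply/existsP; exists x.
  apply/existsP; exists y; rewrite DE eqxx zx zy xy !pz ?set21 ?set22 //=.
  by move: cU le C3; card_lia.
(* An original edge across the separation was removed, so both its ends are in [D]. The third vertex
   of [D] is on at most one side, so the other side meets [D] in a single vertex. *)
have /kconP/(_ A C AW dAC C3 A0 B0)[x [y [xA yW yA yC exy]]] := k3.
have [xD yD _] := diff _ _ exy (noE _ _ xA yW yA yC).
have [d [dD xd yd DE]] := third x y xD yD (neq _ _ exy).
have [dA|dA] := boolP (d \in A); last first.
  apply: (False_rect _ (key A x AW dAC B0 noE xA xD _)) => t tA.
  rewrite DE !inE -orbA => /or3P[/eqP//|/eqP ty|/eqP td].
    by rewrite -ty tA in yA.
  by rewrite -td tA in dA.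
set B := W :\: (A :|: C) in B0.
have inB t : (t \in B) = [&& t \in W, t \notin A & t \notin C].
  by rewrite !inE negb_or andbC.
apply: (False_rect _ (key B y _ _ _ _ _ yD _)).
- exact: subsetDl.
- rewrite -setI_eq0; apply/eqP/setP => t; rewrite inE inB inE.
  by case: (t \in C); rewrite ?andbF.
- case/set0Pn: A0 => t tA; apply/set0Pn; exists t; rewrite !inE (subsetP AW) // tA /=.
  by rewrite (disjointFr dAC).
- move=> s t; rewrite !inB => /and3P[sW sA sC] tW; rewrite tW /= negb_and !negbK.
  move=> tAC tC; rewrite (negPf tC) orbF in tAC.
  by rewrite sym'; apply: noE.
- by rewrite inB yW yA.
- move=> t; rewrite inB DE !inE -orbA => /and3P[tW tA tC] /or3P[/eqP tx|/eqP//|/eqP td].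
    by rewrite tx xA in tA.
  by rewrite td dA in tA.
Qed.

End Connectivity.

(** * Vertices whose removal preserves rigidity *)

Section RemovableVertex.
Local Open Scope nat_scope.
Variables (R : realType) (N : nat).
Local Notation T := 'I_N.
Variable p : T -> bool -> R.
Hypothesis gp : generic_config p.
Implicit Types (W A C F K S Q U V X Y : {set T}) (e : rel T) (XX : {set {set T}}).

Lemma disjoint_notin (A C : {set T}) : {in C, forall t, t \notin A} -> [disjoint A & C].
Proof. by move=> h; rewrite disjoint_sym disjoint_subset; apply/subsetP => t /h. Qed.

Lemma mult_eq XX X Y x : mult XX x <= 1 -> X \in XX -> Y \in XX ->
  x \in X -> x \in Y -> X = Y.
Proof.
by move=> /card_le1_eqP m1 h1 h2 h3 h4; apply: m1; rewrite inE ?h1 ?h2.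
Qed.

Lemma mult_gt0 XX X x : X \in XX -> x \in X -> 0 < mult XX x.
Proof. by move=> h1 h2; apply/card_gt0P; exists X; rewrite inE h1. Qed.

(** In a cover of a flexible [W :\ v], boundary vertices are those in two members. Members with more
    than two vertices have at least three of them, as these and [v] cut off the interior. Counting
    leaves at least four two-element members; each is an edge, and a triangle on it avoiding [v]
    would lie in one member, so its only apex is [v]. *)
Lemma rigid_or_many_private W e v : good W e -> kcon 4 W e -> 4 < #|W| -> v \in W ->
  rigid (W :\ v) e p \/ 3 < #|privs e v|.
Proof.
move=> gW k4 W4 vW; have [sym irr eW tri k3] := gW.
have neq s t : e s t -> s != t by move=> h; apply: contraTneq h => ->; rewrite irr.
have cW : #|W| = #|W :\ v|.+1 by rewrite (cardsD1 v) vW.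
have W1 : 1 < #|W :\ v| by move: cW W4; card_lia.
case: (rigid_or_cover e gp W1) => [|[XX [XX1 XX2 XX3 XX4 XX5]]]; [by left|right].
have deg x : x \in W -> 4 <= #|nbrs e x|.
  by move=> xW; apply: (kcon_degree (W := W)) => // s t; apply: good_memr gW.
have nb2 x (Z : {set T}) : x \in W :\ v -> #|Z| <= 2 ->
    exists2 y, y \in W :\ v & e x y && (y \notin Z).
  move=> xW Z2; have xW' : x \in W by move: xW; rewrite inE => /andP[].
  have : 0 < #|nbrs e x :\: (v |: Z)|.
    have := deg x xW'; have := cardsID (v |: Z) (nbrs e x).
    have := subset_leq_card (subsetIr (nbrs e x) (v |: Z)).
    have : #|v |: Z| <= 1 + #|Z| by rewrite -(cards1 v) leq_card_setU.
    by move: Z2; card_lia.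
  case/card_gt0P => y; rewrite !inE negb_or => /andP[/andP[yv yZ] xy].
  by exists y; rewrite ?inE ?yv ?xy ?yZ // (good_memr gW xy).
have edgeX x y : x \in W :\ v -> y \in W :\ v -> e x y ->
    exists2 X, X \in XX & (x \in X) && (y \in X).
  by move=> xW yW xy; apply: XX3 => //; apply: neq.
have m1 x : x \in W :\ v -> 0 < mult XX x.
  move=> xW; have [|y yW /andP[xy _]] := nb2 x set0 xW; first by rewrite cards0.
  by have [X h1 /andP[h2 _]] := edgeX x y xW yW xy; apply: mult_gt0 h1 h2.
pose Bd := [set x in W :\ v | 1 < mult XX x].
have bd3 X : X \in XX -> 3 <= #|X :&: Bd| + (#|X| == 2).
  move=> XXX; have [XW X1 _] := XX1 X XXX.
  have [X2|X2] := eqVneq #|X| 2.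
    suff /setIidPl -> : X \subset Bd by rewrite X2.
    apply/subsetP => x xX; have xW := subsetP XW x xX.
    rewrite inE xW /= ltnNge; apply/negP => mx.
    have [|y yW /andP[xy yX]] := nb2 x X xW; first by rewrite X2.
    have [Y h1 /andP[h2 h3]] := edgeX x y xW yW xy.
    by case/negP: yX; rewrite (mult_eq mx XXX h1 xX h2).
  rewrite addn0 leqNgt; apply/negP => small.
  have dAC : [disjoint X :\: Bd & v |: (X :&: Bd)].
    rewrite -setI_eq0; apply/eqP/setP => t; rewrite in_set0; apply/negP.
    rewrite in_setI in_setD in_setU1 in_setI => /andP[/andP[tB tX]].
    rewrite (negPf tB) andbF orbF => /eqP tv; have := subsetP XW t tX.
    by rewrite tv !inE eqxx.
  have /kconP/(_ (X :\: Bd) (v |: (X :&: Bd)) _ dAC) k4' := k4.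
  have [||||x [y [xA yW yA yC xy]]] := k4'.
  - apply: (subset_trans (subsetDl _ _)); apply: (subset_trans XW); exact: subD1set.
  - have : #|v |: (X :&: Bd)| <= 1 + #|X :&: Bd| by rewrite -(cards1 v) leq_card_setU.
    by move: small; card_lia.
  - rewrite -card_gt0; have := cardsID Bd X.
    move: X1 X2 small => X1 /eqP X2 small; move: X1 X2 small; card_lia.
  (* A member equal to [W :\ v] would alone exceed the bound on the cover. *)
  - apply: contraT; rewrite negbK => /eqP W0.
    have XE : X = W :\ v.
      apply/eqP; rewrite eqEsubset XW; apply/subsetP => t; rewrite !inE => /andP[tv tW].
      move/setP/(_ t): W0; rewrite in_set0 in_setD in_setU in_setU1 in_setD in_setI.
      rewrite tW (negPf tv).
      by case: (t \in X); rewrite ?andbF.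
    have : 2 * #|X| - 3 <= \sum_(X in XX) (2 * #|X| - 3).
      by rewrite (bigD1 X) //= leq_addr.
    by move: XX5 X1; rewrite -XE; set s := \sum_(_ in _) _; card_lia.
  move: xA; rewrite in_setD => /andP[xB xX]; have xW := subsetP XW x xX.
  have yX : y \notin X.
    apply: contra yA => yX; rewrite in_setD yX andbT; apply: contra yC => yB.
    by rewrite in_setU1 in_setI yX yB orbT.
  have yWv : y \in W :\ v.
    by rewrite in_setD1 yW andbT; apply: contraNneq yC => ->; rewrite setU11.
  have [Y h1 /andP[h2 h3]] := edgeX x y xW yWv xy.
  have mx : mult XX x <= 1 by rewrite leqNgt; apply: contra xB => mx; rewrite inE xW.
  by case/negP: yX; rewrite (mult_eq mx XXX h1 xX h2).
have := @cover_count _ (W :\ v) XX Bd set0 (sub0set _) _ _ bd3 _ XX5.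
rewrite cards0 add0n => cnt.
apply: (@leq_trans #|[set X in XX | #|X| == 2]|).
  apply: cnt.
  - by apply/subsetP => x; rewrite inE => /andP[].
  - by move=> X /XX1[].
  - move=> x xW; rewrite in_set0 inE xW /=; have := m1 x xW.
    by move: (mult XX x) => k; clear; case: ltnP => /=; lia.
apply/subset_leq_card/subsetP => X; rewrite inE => /andP[XXX /eqP X2].
have [XW _ [s [t [sX tX st est]]]] := XX1 X XXX.
have sW := subsetP XW s sX; have tW := subsetP XW t tX.
have XE : X = [set s; t].
  by apply/esym/eqP; rewrite eqEcard subUset !sub1set sX tX X2 cards2 st.
have onlyv z : e s z -> e t z -> z = v.
  move=> sz tz; apply/eqP; apply: contraT => zv.
  have zW : z \in W :\ v by rewrite in_setD1 zv (good_memr gW sz).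
  have [Y YY /and3P[sY tY zY]] : exists2 X, X \in XX & [&& s \in X, t \in X & z \in X].
    by apply: XX4 => //; split=> //; apply: neq.
  have [XY|XY] := eqVneq X Y.
    move: zY; rewrite -XY XE !inE => /orP[]/eqP ez; move: sz tz; rewrite ez ?irr //.
  have := XX2 X Y XXX YY XY; rewrite leqNgt; case/negP.
  by apply/card_gt1P; exists s, t; rewrite !inE sX tX sY tY.
rewrite inE; apply/existsP; exists s; apply/existsP; exists t.
rewrite XE eqxx /=; have [r /andP[sr tr]] := tri s t est.
have rv := onlyv r sr tr; rewrite rv in sr tr.
rewrite /pedge est sym sr sym tr /=.
apply/forallP => z; apply/forallP => w; apply/implyP => /and4P[h1 h2 h3 h4].
by rewrite (onlyv z) // (onlyv w).
Qed.

Lemma rigid_separated_side W e Q S : good W e -> S \subset W -> Q \subset W ->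
  #|S| = 3 -> [disjoint Q & S] -> Q != set0 -> W :\: (Q :|: S) != set0 ->
  (forall x y, x \in Q -> e x y -> y \in Q :|: S) -> rigid (Q :|: S) e p.
Proof.
move=> gW SW QW S3 dQS Q0 F0 clos; have [sym irr eW tri k3] := gW.
have neq s t : e s t -> s != t by move=> h; apply: contraTneq h => ->; rewrite irr.
set V := Q :|: S; have VW : V \subset W by rewrite subUset QW.
have cV : 3 < #|V|.
  have := cardsUI Q S; have -> : Q :&: S = set0 by apply/eqP; rewrite setI_eq0.
  rewrite cards0 S3; have : 0 < #|Q| by rewrite card_gt0.
  by rewrite -/V; card_lia.
have W3 : 3 < #|W| by apply: (leq_trans cV); apply: subset_leq_card.
have V1 : 1 < #|V| by move: cV; card_lia.
case: (rigid_or_cover e gp V1) => [//|[XX [XX1 XX2 XX3 XX4 XX5]]]; exfalso.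
pose XX' := [set X in XX | 2 < #|X|].
have inXX' X : X \in XX' -> X \in XX by rewrite inE => /andP[].
have inV x : x \in Q -> x \in V by move=> xQ; rewrite inE xQ.
have edgeX x y : x \in Q -> e x y -> exists2 X, X \in XX' & (x \in X) && (y \in X).
  move=> xQ xy; have [r /andP[xr yr]] := tri x y xy.
  have [|||X XXX /and3P[h1 h2 h3]] := XX4 x y r.
  - by split; [exact: inV | exact: clos xy | exact: clos xr].
  - by split; apply: neq.
  - by split.
  exists X; last by rewrite h1 h2.
  rewrite inE XXX; apply/card_gt2P; exists x, y, r; split=> //.
  by split; apply: neq => //; rewrite sym.
have m1 x : x \in V -> 0 < mult XX' x.
  rewrite inE => /orP[xQ|xS].
    have : 0 < #|nbrs e x| by have := good_degree gW (subsetP QW x xQ) W3; card_lia.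
    case/card_gt0P => y; rewrite inE => xy.
    by have [X h1 /andP[h2 _]] := edgeX x y xQ xy; apply: mult_gt0 h1 h2.
  (* The other two vertices of [S] do not separate [x] from [Q], so [x] has a neighbour in [Q]. *)
  have /kconP/(_ Q (S :\ x) QW) k3' := k3.
  have [||||y [z [yQ zW zQ zS yz]]] := k3'.
  - by apply: disjointWr dQS; exact: subD1set.
  - by move: S3; rewrite (cardsD1 x) xS; card_lia.
  - by [].
  - apply/set0Pn; exists x; rewrite !inE eqxx /= (subsetP SW) // orbF andbT.
    by rewrite (disjointFl dQS).
  have zx : z = x.
    have := clos _ _ yQ yz; rewrite inE (negPf zQ) /= => zS'.
    by apply/eqP; move: zS; rewrite in_setD1 zS' andbT negbK.
  by have [X h1 /andP[_ h2]] := edgeX y z yQ yz; rewrite -zx; apply: mult_gt0 h1 h2.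
pose Bd := S :|: [set x in Q | 1 < mult XX' x].
have bd3 X : X \in XX' -> 3 <= #|X :&: Bd| + (#|X| == 2).
  move=> XXX; have X3 : 2 < #|X| by move: XXX; rewrite inE => /andP[].
  apply: (leq_trans _ (leq_addr _ _)); rewrite leqNgt; apply/negP => small.
  have [XV _ _] := XX1 X (inXX' _ XXX).
  have dAC : [disjoint X :\: Bd & X :&: Bd].
    rewrite -setI_eq0; apply/eqP/setP => t; rewrite in_set0 in_setI in_setD in_setI.
    by case: (t \in Bd); rewrite ?andbF.
  have /kconP/(_ (X :\: Bd) (X :&: Bd) _ dAC small) k3' := k3.
  have [|||x [y [xA yW yA yC xy]]] := k3'.
  - apply: (subset_trans (subsetDl _ _)); exact: subset_trans XV VW.
  - by rewrite -card_gt0; have := cardsID Bd X; move: X3 small; card_lia.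
  - case/set0Pn: F0 => t; rewrite -/V in_setD => /andP[tV tW]; apply/set0Pn; exists t.
    rewrite in_setD tW andbT; apply: contra tV => tX; apply: (subsetP XV).
    by move: tX; rewrite in_setU in_setD in_setI => /orP[]/andP[].
  move: xA; rewrite in_setD => /andP[xB xX]; have xV := subsetP XV x xX.
  have yX : y \notin X.
    apply: contra yA => yX; rewrite in_setD yX andbT; apply: contra yC => yB.
    by rewrite in_setI yX yB.
  have xQ : x \in Q.
    move: xV xB; rewrite inE in_setU => /orP[//|->] //.
  have [Y h1 /andP[h2 h3]] := edgeX x y xQ xy.
  have mx : mult XX' x <= 1.
    by rewrite leqNgt; apply: contra xB => mx; rewrite in_setU inE xQ mx orbT.
  by case/negP: yX; rewrite (mult_eq mx XXX h1 xX h2).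
have : 3 < #|S| + #|[set X in XX' | #|X| == 2]|.
  apply: (@cover_count _ V _ Bd) => //.
  - exact: subsetUr.
  - rewrite subUset subsetUr; apply/subsetP => x; rewrite inE => /andP[xQ _]; exact: inV.
  - by move=> X /inXX'/XX1[].
  - move=> x xV; have := m1 x xV; move: xV; rewrite in_setU => /orP[xQ|xS].
      have xS : x \in S = false by rewrite (disjointFr dQS).
      rewrite xS in_setU xS inE xQ /=.
      by move: (mult XX' x) => k; clear; case: ltnP => /=; lia.
    by rewrite in_setU xS /=; move: (mult XX' x) => k; clear; lia.
  - apply: leq_ltn_trans XX5; rewrite leq_add2r big_mkcond [X in _ <= X]big_mkcond.
    apply: leq_sum => X _; case: ifP => [/inXX' ->//|_]; by case: ifP.
rewrite S3 (_ : [set X in XX' | #|X| == 2] = set0) ?cards0 //.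
apply/setP => X; rewrite !inE; apply/negP => /andP[/andP[_ X3] /eqP X2].
by rewrite X2 in X3.
Qed.

Lemma trivial_motion_glue (V W : {set T}) u s t : s != t ->
  s \in V -> t \in V -> s \in W -> t \in W ->
  trivial_motion V p u -> trivial_motion W p u -> trivial_motion (V :|: W) p u.
Proof.
move=> st sV tV sW tW [w [x [y h]]] [w' [x' [y' h']]].
have [s1 s2] := h s sV; have [t1 t2] := h t tV.
have [s1' s2'] := h' s sW; have [t1' t2'] := h' t tW.
have neq := generic_coord_neq false gp st.
have ww : w = w'.
  apply/eqP; rewrite -subr_eq0; apply: contraT => w0.
  case/eqP: (mulf_neq0 w0 neq); rewrite mulrBl !mulrBr.
  by move: s2 t2; rewrite s2' t2'; lra.
exists w, x, y => k; rewrite inE => /orP[/h//|/h'[-> ->]]; subst w'.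
by split; [have := s1; rewrite s1' | have := s2; rewrite s2']; lra.
Qed.

Definition clique_join e S : rel T :=
  fun s t => (s != t) && (e s t || (s \in S) && (t \in S)).

(** Fewer than three removed vertices leave a part of [S], which as a clique stays on one side. The
    other side avoids [S], so all its neighbours are in [V], and it would already be separated in
    [W]. *)
Lemma good_clique_join W e V S : good W e -> V \subset W -> S \subset V ->
  2 < #|S| -> (forall x y, x \in V -> x \notin S -> e x y -> y \in V) ->
  good V (fun s t => [&& s \in V, t \in V & clique_join e S s t]).
Proof.
move=> gW VW /subsetP SV S3 nbV; have [sym irr eW tri k3] := gW.
have neq s t : e s t -> s != t by move=> h; apply: contraTneq h => ->; rewrite irr.
set e1 := fun s t => _.
have ee1 s t : s \in V -> t \in V -> e s t -> e1 s t.
  by move=> sV tV st; rewrite /e1 /clique_join sV tV st neq.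
have sym1 : ssrbool.symmetric e1.
  move=> s t; rewrite /e1 /clique_join eq_sym sym andbCA; congr [&& _, _, _ & _ || _].
  exact: andbC.
have S1 s t : s \in S -> t \in S -> s != t -> e1 s t.
  by move=> sS tS st; rewrite /e1 /clique_join !SV // st sS tS orbT.
split=> //.
- by move=> s; rewrite /e1 /clique_join eqxx !andbF.
- by move=> s t /and3P[].
- move=> s t /and3P[sV tV /andP[st]].
  have [/andP[sS tS] _|nS] := boolP ((s \in S) && (t \in S)).
    have : 0 < #|S :\: [set s; t]|.
      have := cardsID [set s; t] S; have := subset_leq_card (subsetIr S [set s; t]).
      by move: S3; rewrite cards2; case: (s != t); card_lia.
    case/card_gt0P => r; rewrite !inE negb_or => /andP[/andP[rs rt] rS].
    by exists r; rewrite !S1 // eq_sym.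
  rewrite orbF => est; have [r /andP[sr tr]] := tri s t est.
  suff rV : r \in V by exists r; rewrite !ee1.
  by move: nS; rewrite negb_and => /orP[sS|tS]; [apply: nbV sr | apply: nbV tr].
apply/kconP => A C AV dAC C3 A0 B0.
apply/'exists_'exists_and5P; apply: contraT; rewrite negb_exists => /forallP no1.
have {}no1 x y : x \in A -> y \in V -> y \notin A -> y \notin C -> ~~ e1 x y.
  move=> xA yW yA yC; have := no1 x; rewrite negb_exists => /forallP/(_ y).
  by rewrite xA yW yA yC.
have key U : U \subset V -> [disjoint U & C] -> U != set0 ->
    V :\: (U :|: C) != set0 -> [disjoint U & S] ->
    (forall x y, x \in U -> y \in V -> y \notin U -> y \notin C -> ~~ e1 x y) -> False.
  move=> UV dUC U0 V0 dUS noU; have /kconP/(_ U C _ dUC C3 U0) k3' := k3.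
  have [||x [y [xU yW yU yC xy]]] := k3'; first exact: subset_trans VW.
    case/set0Pn: V0 => t; rewrite in_setD => /andP[tUC tV].
    by apply/set0Pn; exists t; rewrite in_setD tUC (subsetP VW).
  have xV := subsetP UV x xU.
  have yV : y \in V by apply: nbV xy => //; rewrite (disjointFr dUS xU).
  by have := noU _ _ xU yV yU yC; rewrite ee1.
have [s sS sC] : exists2 s, s \in S & s \notin C.
  apply/exists_inP; apply: contraT; rewrite negb_exists_in => /forall_inP SC.
  have : S \subset C by apply/subsetP => s /SC; rewrite negbK.
  by move/subset_leq_card; move: S3 C3; card_lia.
have [sA|sA] := boolP (s \in A); last first.
  apply: (False_rect _ (key A AV dAC A0 B0 _ no1)).
  apply: disjoint_notin => t tS; apply/negP => tA.
  have ts : t != s by apply: contraNneq sA => <-.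
  by have := no1 t s tA (SV _ sS) sA sC; rewrite S1.
set B := V :\: (A :|: C) in B0.
have inB t : (t \in B) = [&& t \in V, t \notin A & t \notin C].
  by rewrite in_setD in_setU negb_or andbC.
apply: (False_rect _ (key B _ _ B0 _ _ _)).
- exact: subsetDl.
- rewrite -setI_eq0; apply/eqP/setP => t; rewrite in_setI inB in_set0.
  by case: (t \in C); rewrite ?andbF.
- case/set0Pn: A0 => t tA; apply/set0Pn; exists t; rewrite in_setD in_setU inB tA.
  by rewrite (disjointFr dAC) // (subsetP AV) // andbF.
- apply: disjoint_notin => t tS; apply/negP; rewrite inB => /and3P[tV tA tC].
  have st : s != t by apply: contraNneq tA => <-.
  by have := no1 s t sA tV tA tC; rewrite S1.
- move=> x y; rewrite !inB => /and3P[xV xA xC] yV; rewrite yV /= negb_and !negbK.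
  move=> yAC yC; rewrite (negPf yC) orbF in yAC.
  by rewrite sym1; apply: no1.
Qed.

Definition removable_outside W e K :=
  exists v, [/\ v \in W, v \notin K & rigid (W :\ v) e p].

(** Induction on vertices, then on edges. Prescribing the clique [K] is what permits recursion at a
    3-separator [S]: with [S] in the role of [K], the vertex returned lies strictly inside the
    chosen side. *)
Lemma removable_vertex W e K : good W e -> 3 < #|W| -> K \subset W -> #|K| = 3 ->
  {in K &, forall s t, s != t -> e s t} -> removable_outside W e K.
Proof.
move: {2}#|W| (leqnn #|W|) => n; elim: n W e K => [|n IHn] W e K.
  by rewrite leqn0 => /eqP ->.
move: {2}#|[set f : T * T | e f.1 f.2]| (leqnn #|[set f : T * T | e f.1 f.2]|) => m.
elim: m e K => [|m IHm] e K em Wn gW W3 KW K3 clK.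
  have [s sW] : exists s, s \in W by apply/card_gt0P; move: W3; card_lia.
  have /card_gt0P[t] : 0 < #|nbrs e s| by have := good_degree gW sW W3; card_lia.
  rewrite inE => st; suff : false by [].
  rewrite leqn0 cards_eq0 in em; move/eqP/setP/(_ (s, t)): em.
  by rewrite !inE /= st.
have [sym irr eW tri k3] := gW.
have neq s t : e s t -> s != t by move=> h; apply: contraTneq h => ->; rewrite irr.
have [v vW vK] : exists2 v, v \in W & v \notin K.
  have : 0 < #|W :\: K| by rewrite cardsDS // K3; move: W3; card_lia.
  by case/card_gt0P => v; rewrite inE => /andP[vK vW]; exists v.
have [W4|W4] := leqP #|W| 4.
  exists v; split=> //; have -> : W :\ v = K.
    apply/esym/eqP; rewrite eqEcard K3; apply/andP; split.
      by apply/subsetP => x xK; rewrite in_setD1 (subsetP KW) // andbT;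
         apply: contraNneq vK => <-.
    by move: W4; rewrite (cardsD1 v) vW; card_lia.
  by apply: rigid_complete => //; rewrite K3.
have [k4|] := boolP (kcon 4 W e); last first.
  rewrite negb_forall => /existsP[A]; rewrite negb_forall => /existsP[C].
  rewrite negb_imply => /andP[/and5P[AW dAC C4 A0 B0] noE].
  pose S := C :&: W; pose B := W :\: (A :|: S).
  have SW : S \subset W by exact: subsetIr.
  have BE : W :\: (A :|: C) = B.
    apply/setP => x; rewrite !inE; case: (x \in W); rewrite ?andbF ?andbT //.
  rewrite BE in B0 noE.
  have {}noE x y : x \in A -> y \in B -> ~~ e x y.
    move=> xA yB; apply: contra noE => xy.
    by apply/exists_inP; exists x => //; apply/exists_inP; exists y.
  have dAS : [disjoint A & S] by apply: disjointWr dAC; exact: subsetIl.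
  have S3 : #|S| = 3.
    have : #|S| <= #|C| by apply: subset_leq_card; exact: subsetIl.
    have : 2 < #|S|.
      rewrite ltnNge; apply/negP => S2; have /kconP k3' := k3.
      have [x [y [xA yW yA yS xy]]] := k3' A S AW dAS S2 A0 B0.
      have yB : y \in B by rewrite in_setD in_setU negb_or yA yS.
      by have := noE _ _ xA yB; rewrite xy.
    by move: C4; card_lia.
  have inB t : (t \in B) = [&& t \in W, t \notin A & t \notin S].
    by rewrite in_setD in_setU negb_or andbC.
  have dAB : [disjoint A & B].
    by apply: disjoint_notin => t; rewrite inB => /and3P[].
  have dBS : [disjoint B & S].
    by apply: disjoint_notin => t tS; rewrite inB tS !andbF.
  (* [F] is the side free of [K], where the vertex is sought; [Q] is the other side, which is rigid
     together with [S]. *)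
  have side F Q : F \subset W -> Q \subset W -> W \subset F :|: Q :|: S ->
      [disjoint F & Q] -> [disjoint F & S] -> [disjoint Q & S] ->
      F != set0 -> Q != set0 -> (forall x y, x \in F -> y \in Q -> ~~ e x y) ->
      (forall x, x \in F -> x \notin K) -> removable_outside W e K.
    move=> FW QW WFQ dFQ dFS dQS F0 Q0 noFQ FK.
    pose V := F :|: S; have VW : V \subset W by rewrite subUset FW.
    have g1 : good V (fun s t => [&& s \in V, t \in V & clique_join e S s t]).
      apply: (good_clique_join gW) => //; rewrite ?subsetUr ?S3 // => a b.
      rewrite in_setU => /orP[aF _ ab|->//].
      have := subsetP WFQ b (good_memr gW ab); rewrite !in_setU.
      case/orP=> [/orP[->//|bQ]|->]; last by rewrite orbT.
      by have := noFQ a b aF bQ; rewrite ab.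
    set e1 := fun s t => _ in g1.
    have [x xQ] := set0Pn _ Q0.
    have xV : x \notin V.
      by rewrite in_setU (disjointFl dFQ xQ) (disjointFr dQS xQ).
    have Vn : #|V| <= n.
      rewrite -ltnS; apply: leq_trans Wn; apply: proper_card; apply/properP; split=> //.
      by exists x => //; apply: (subsetP QW).
    have V3 : 3 < #|V|.
      have := cardsUI F S; have -> : F :&: S = set0 by apply/eqP; rewrite setI_eq0.
      rewrite cards0 S3; have : 0 < #|F| by rewrite card_gt0.
      by rewrite -/V; card_lia.
    have clS : {in S &, forall s t, s != t -> e1 s t}.
      by move=> s t sS tS st; rewrite /e1 /clique_join !in_setU sS tS st !orbT.
    have [w [wV wS rw]] := IHn V e1 S Vn g1 V3 (subsetUr _ _) S3 clS.
    have wF : w \in F by move: wV; rewrite in_setU (negPf wS) orbF.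
    exists w; split; [exact: (subsetP FW) | exact: FK |].
    have rQ : rigid (Q :|: S) e p.
      apply: (@rigid_separated_side W) => //.
        case/set0Pn: F0 => y yF; apply/set0Pn; exists y.
        by rewrite in_setD in_setU (disjointFr dFQ yF) (disjointFr dFS yF) (subsetP FW).
      move=> a b aQ ab; have := subsetP WFQ b (good_memr gW ab).
      rewrite !in_setU => /orP[/orP[bF|->//]|->]; last by rewrite orbT.
      by have := noFQ b a bF aQ; rewrite sym ab.
    have wQ : w \notin Q :|: S by rewrite in_setU (disjointFr dFQ wF).
    move=> u fu.
    have tQ : trivial_motion (Q :|: S) p u.
      apply: rQ; apply: flexS fu => //; apply/subsetP => y yQS.
      rewrite in_setD1; apply/andP; split; first by apply: contraNneq wQ => <-.
      by move: yQS; rewrite in_setU => /orP[/(subsetP QW)|/(subsetP SW)].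
    (* The edges added within [S] impose nothing new on [u], because [u] is trivial on [Q :|: S]. *)
    have tV : trivial_motion (V :\ w) p u.
      apply: rw => s t sV tV' /and3P[_ _ /andP[st /orP[est|/andP[sS tS]]]].
        apply: fu est; first by apply: subsetP sV; apply: setSD.
        by apply: subsetP tV'; apply: setSD.
      by apply: (trivial_motion_dot tQ); rewrite in_setU ?sS ?tS orbT.
    have /card_gt1P[s1 [s2 [s1S s2S s12]]] : 1 < #|S| by rewrite S3.
    have SVw y : y \in S -> y \in V :\ w.
      move=> yS; rewrite in_setD1 in_setU yS orbT andbT.
      by apply: contraNneq wS => <-.
    have := trivial_motion_glue s12 (SVw _ s1S) (SVw _ s2S) _ _ tV tQ.
    rewrite !in_setU s1S s2S !orbT => /(_ isT isT) [a [b [c h]]].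
    exists a, b, c => k; rewrite in_setD1 => /andP[kw kW]; apply: h.
    have := subsetP WFQ k kW; rewrite !in_setU in_setD1 kw /= in_setU.
    by case: (k \in F); case: (k \in Q); case: (k \in S).
  have WAB : W \subset A :|: B :|: S.
    apply/subsetP => x xW; rewrite !in_setU inB xW.
    by case: (x \in A); case: (x \in S).
  have BW : B \subset W by exact: subsetDl.
  (* A clique cannot have vertices on both sides, so one side avoids [K]. *)
  have [/exists_inP[a aA aK]|/exists_inPn AK] := boolP [exists x in A, x \in K].
    apply: (side B A) => //; first by rewrite (setUC B).
    - by rewrite disjoint_sym.
    - by move=> x y xB yA; rewrite sym; apply: noE.
    move=> x xB; apply/negP => xK; have := noE a x aA xB.
    by rewrite clK //; apply: contraTneq xB => <-; rewrite inB aA andbF.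
  exact: (side A B).
have edge_v X : X \in privs e v -> removable_outside W e K \/
    exists z, [/\ z \in X, z \in K, prv e z v & e z v].
  rewrite inE => /existsP[a /existsP[b /andP[/eqP-> pab]]].
  have [ab va vb prab] := and4P pab.
  have [g'|[z [x [y [DE [zx zy xy] pzx pzy d4]]]]] :=
    private_triangle_removal gW k4 W4 pab.
    left; set e' := drop_private _ _ in g'.
    have em' : #|[set f : T * T | e' f.1 f.2]| <= m.
      rewrite -ltnS; apply: leq_trans em; apply: proper_card; apply/properP; split.
        by apply/subsetP => f; rewrite !inE => /andP[].
      exists (a, b); rewrite !inE //=.
      by rewrite /e' /drop_private !inE !eqxx prab /= orbT /= andbF.
    (* Edges of [K] survive: a removed one would have two common neighbours of its ends, [v] and the
       third vertex of [K]. *)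
    have clK' : {in K &, forall s t, s != t -> e' s t}.
      move=> s t sK tK st; rewrite /e' /drop_private clK //=.
      apply/negP => /and3P[sD tD pst].
      have adjv r : r \in K -> r \in [set a; b; v] -> e r v.
        move=> rK; rewrite !inE -orbA => /or3P[/eqP->|/eqP->|/eqP er].
        - by rewrite sym.
        - by rewrite sym.
        by rewrite -er rK in vK.
      have : 0 < #|K :\: [set s; t]|.
        have := cardsID [set s; t] K; have := subset_leq_card (subsetIr K [set s; t]).
        by rewrite K3 cards2 st; card_lia.
      case/card_gt0P => r; rewrite !inE negb_or => /andP[/andP[rs rt] rK].
      have rv : r = v.
        apply: (prvP pst); try exact: adjv; by apply: clK => //; rewrite eq_sym.
      by rewrite -rv rK in vK.
    have [w [wW wK rw]] := IHm e' K em' Wn g' W3 KW K3 clK'.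
    exists w; split=> //; apply: rigid_edgeS rw => s t _ _; by case/andP.
  have zD : z \in [set a; b; v] by rewrite DE !inE eqxx.
  have vD : v \in [set z; x; y] by rewrite -DE !inE eqxx !orbT.
  (* Outside [K], [z] itself is removable, as [few_private] excludes four private edges with apex
     [z]. *)
  have [zK|zK] := boolP (z \in K); last first.
    left; exists z; split=> //; first exact: eW zx.
    case: (rigid_or_many_private gW k4 W4 (eW _ _ zx)) => // many.
    have := few_private sym irr zx zy xy pzx pzy d4.
    by move: many; card_lia.
  right; exists z.
  have zv : z != v by apply: contraNneq vK => <-.
  have {}zD : (z == a) || (z == b) by move: zD; rewrite !inE (negPf zv) orbF.
  move: vD; rewrite !inE [v == z]eq_sym (negPf zv) /= => /orP[]/eqP ->; split=> //.
case: (rigid_or_many_private gW k4 W4 vW) => [rv|many]; first by exists v.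
pose hasz X := [pick z | [&& z \in X, z \in K, prv e z v & e z v]].
have [/forall_inP all|] := boolP [forall X in privs e v, hasz X != None]; last first.
  rewrite negb_forall_in => /exists_inP[X Xp]; rewrite negbK /hasz.
  case: pickP => // noz _; case: (edge_v X Xp) => // -[z [h1 h2 h3 h4]].
  by have := noz z; rewrite h1 h2 h3 h4.
pose g X := odflt v (hasz X).
have gP X : X \in privs e v -> [/\ g X \in X, g X \in K, prv e (g X) v & e (g X) v].
  move=> /all; rewrite /g /hasz; by case: pickP => // z /and4P[].
have XE X : X \in privs e v -> exists y, [/\ X = [set g X; y], e (g X) y & e v y].
  move=> Xp; have [gX _ _ _] := gP X Xp.
  move: (g X) gX Xp => z zX; rewrite inE.
  move=> /existsP[a /existsP[b /andP[/eqP eX /and4P[ab va vb _]]]].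
  move: zX; rewrite eX !inE => /orP[]/eqP ->.
    by exists b.
  by exists a; rewrite setUC sym.
(* The edge from [z] to [v] lies in only one triangle, so [z] determines the pair; four pairs do not
   fit into the three vertices of [K]. *)
have inj : {in privs e v &, injective g}.
  move=> X Y Xp Yp gXY; have [y [eX gy vy]] := XE X Xp; have [z [eY gz vz]] := XE Y Yp.
  have [_ _ pg _] := gP X Xp; rewrite -gXY in gz eY.
  by rewrite eX eY (prvP pg gy vy gz vz).
have : #|privs e v| <= #|K|.
  rewrite -(card_in_imset inj); apply: subset_leq_card; apply/subsetP => z.
  by case/imsetP => X Xp ->; have [] := gP X Xp.
by rewrite K3; move: many; card_lia.
Qed.
End RemovableVertex.

(** * Global rigidity *)

Section GlobalRigidity.
Variables (R : realType) (N : nat).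
Local Notation T := 'I_N.
Local Notation config := (T -> bool -> R).
Implicit Types (p q u : config) (e : rel T) (W : {set T}).

Definition same_dist p q s t := dot q q s t = dot p p s t.

Lemma same_dist_sym p q s t : same_dist p q s t -> same_dist p q t s.
Proof. by rewrite /same_dist => h; rewrite dot_sym h dot_sym. Qed.

Lemma same_dist_refl p q s : same_dist p q s s.
Proof. by rewrite /same_dist /dot !subrr !mul0r. Qed.

(** The squared distance from [y] to an affine combination of [a], [b], [c] is a polynomial in the
    mutual squared distances, here [Phi], so its vanishing carries over from [p] to [q]. *)
Lemma common_affine_coordinates p q a b c y : area p a b c != 0 ->
  same_dist p q b a -> same_dist p q c a -> same_dist p q b c ->
  same_dist p q y a -> same_dist p q y b -> same_dist p q y c ->
  exists s t, forall d,
    p y d = p a d + s * (p b d - p a d) + t * (p c d - p a d) /\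
    q y d = q a d + s * (q b d - q a d) + t * (q c d - q a d).
Proof.
move=> ar ba ca bc ya yb yc.
pose s := area p a y c / area p a b c; pose t := area p a b y / area p a b c.
have ep d : p y d = p a d + s * (p b d - p a d) + t * (p c d - p a d).
  apply: (mulfI ar); transitivity (area p a b c * p a d +
    (s * area p a b c) * (p b d - p a d) + (t * area p a b c) * (p c d - p a d)).
    by rewrite /s /t !divfK // /area; case: d; ring.
  by ring.
pose del (x : config) d := x y d - (x a d + s * (x b d - x a d) + t * (x c d - x a d)).
pose Phi (x : config) := dot x x y a + s ^+ 2 * dot x x b a + t ^+ 2 * dot x x c a
  - s * (dot x x y a + dot x x b a - dot x x y b)
  - t * (dot x x y a + dot x x c a - dot x x y c)
  + s * t * (dot x x b a + dot x x c a - dot x x b c).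
have delE x : del x false ^+ 2 + del x true ^+ 2 = Phi x by rewrite /del /Phi /dot; ring.
have del0 : del q false ^+ 2 + del q true ^+ 2 = 0.
  rewrite delE; have -> : Phi q = Phi p.
    by rewrite /Phi /= [dot q q y a]ya [dot q q b a]ba [dot q q c a]ca
               [dot q q y b]yb [dot q q y c]yc [dot q q b c]bc.
  by rewrite -delE /del -!ep !subrr expr0n addr0.
exists s, t => d; split; first exact: ep.
apply/eqP; rewrite -subr_eq0 -/(del q d); move/eqP: del0.
by rewrite paddr_eq0 ?sqr_ge0 // !sqrf_eq0 => /andP[]; case: d.
Qed.

(** [x] and [y] each keep their affine coordinates, so the squared length of [x]-[y] is the same
    quadratic expression in the sides of the triangle for [p] and [q]. *)
Lemma same_dist_extend p q a b c x y : area p a b c != 0 ->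
  {in [:: a; b; c] &, forall s t, same_dist p q s t} ->
  {in [:: a; b; c], forall s, same_dist p q x s} ->
  {in [:: a; b; c], forall s, same_dist p q y s} -> same_dist p q x y.
Proof.
move=> ar h hx hy.
have am : a \in [:: a; b; c] by rewrite !inE eqxx.
have bm : b \in [:: a; b; c] by rewrite !inE eqxx orbT.
have cm : c \in [:: a; b; c] by rewrite !inE eqxx !orbT.
have [s [t es]] := common_affine_coordinates ar (h _ _ bm am) (h _ _ cm am) (h _ _ bm cm)
  (hx _ am) (hx _ bm) (hx _ cm).
have [s' [t' es']] := common_affine_coordinates ar (h _ _ bm am) (h _ _ cm am) (h _ _ bm cm)
  (hy _ am) (hy _ bm) (hy _ cm).
have [p0 q0] := es false; have [p1 q1] := es true.
have [p0' q0'] := es' false; have [p1' q1'] := es' true.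
pose Phi (z : config) := (s - s') ^+ 2 * dot z z b a + (t - t') ^+ 2 * dot z z c a
  + (s - s') * (t - t') * (dot z z b a + dot z z c a - dot z z b c).
have -> : same_dist p q x y = (Phi q = Phi p).
  by rewrite /same_dist /Phi /dot p0 q0 p1 q1 p0' q0' p1' q1'; congr (_ = _); ring.
by rewrite /Phi [dot q q b a]h // [dot q q c a]h // [dot q q b c]h.
Qed.

(** For a removable [v], [star_distance] preserves the distances among its neighbours. These may
    thus be joined, induction applies to the rest, and three neighbours fix [v]. *)
Lemma global_rigidity p q W e : generic_config p -> good W e -> (3 < #|W|)%N ->
  (forall s t, e s t -> same_dist p q s t) ->
  {in W &, forall s t, same_dist p q s t}.
Proof.
move=> gp; move: {2}#|W| (leqnn #|W|) => n; elim: n W e => [|n IH] W e.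
  by rewrite leqn0 => /eqP ->.
move=> Wn gW W3 eqe; have [sym irr eW tri k3] := gW.
have neq s t : e s t -> s != t by move=> h; apply: contraTneq h => ->; rewrite irr.
have [W4|W4] := leqP #|W| 4.
  move=> s t sW tW; have [->|st] := eqVneq s t; first exact: same_dist_refl.
  apply: eqe; have sub : nbrs e s \subset W :\ s.
    apply/subsetP => x; rewrite !inE => sx.
    by rewrite (good_memr gW sx) eq_sym neq.
  have : nbrs e s = W :\ s.
    apply/eqP; rewrite eqEcard sub; have := good_degree gW sW W3.
    by move: W4; rewrite (cardsD1 s) sW; card_lia.
  by move/setP/(_ t); rewrite !inE eq_sym st tW.
have [s0 s0W] : exists s, s \in W by apply/card_gt0P; move: W3; card_lia.
have /card_gt0P[t0] : (0 < #|nbrs e s0|)%N by have := good_degree gW s0W W3; card_lia.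
rewrite inE => st0; have [r0 /andP[sr0 tr0]] := tri _ _ st0.
pose K := [set s0; t0; r0].
have K3 : #|K| = 3%N.
  by rewrite /K setUC cardsU1 !inE cards2 negb_or ![r0 == _]eq_sym !neq.
have KW : K \subset W.
  by rewrite !subUset !sub1set s0W (good_memr gW st0) (good_memr gW sr0).
have clK : {in K &, forall s t, s != t -> e s t}.
  move=> s t; rewrite !inE -!orbA => /or3P[]/eqP-> /or3P[]/eqP->; rewrite ?eqxx //;
  by rewrite sym.
have [v [vW vK rv]] := removable_vertex gp gW W3 KW K3 clK.
set S := nbrs e v; set V := W :\ v.
have SV : S \subset V.
  apply/subsetP => x; rewrite !inE => vx.
  by rewrite (good_memr gW vx) eq_sym neq.
have S3 : (2 < #|S|)%N by exact: good_degree W3.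
have vV : v \notin V by rewrite !inE eqxx.
have eqS s t : s \in S -> t \in S -> same_dist p q s t.
  move=> sS tS; have [->|st] := eqVneq s t; first exact: same_dist_refl.
  have : (0 < #|S :\: [set s; t]|)%N.
    have := cardsID [set s; t] S; have := subset_leq_card (subsetIr S [set s; t]).
    by move: S3; rewrite cards2 st; card_lia.
  case/card_gt0P => r; rewrite !inE negb_or => /andP[/andP[rs rt] rS].
  have inV x : x \in S -> x \in V by apply: subsetP.
  apply: (@star_distance _ _ p q V e v s t r) => //.
  - exact: inV.
  - exact: inV.
  - by apply: inV; rewrite inE.
  - by rewrite eq_sym.
  - by rewrite eq_sym.
  - by move=> x y _ _; apply: eqe.
  - by apply: eqe; move: sS; rewrite inE.
  - by apply: eqe; move: tS; rewrite inE.
  - exact: eqe.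
have g1 : good V (fun s t => [&& s \in V, t \in V & clique_join e S s t]).
  apply: (good_clique_join gW) => //; first exact: subD1set.
  move=> x y _ xS xy; rewrite !inE (good_memr gW xy) andbT.
  by apply: contraNneq xS => yv; rewrite inE sym -yv.
have cV : #|W| = #|V|.+1 by rewrite (cardsD1 v) vW.
have eqV : {in V &, forall s t, same_dist p q s t}.
  apply: (IH V _ _ g1); first by rewrite -ltnS -cV.
    by rewrite -ltnS -cV.
  by move=> s t /and3P[_ _ /andP[_ /orP[/eqe//|/andP[]]]]; exact: eqS.
have /card_gt2P[a [b [c [[aS bS cS] [ab bc ca]]]]] := S3.
have ar : area p a b c != 0 by apply: generic_area => //; rewrite eq_sym.
have inV x : x \in [:: a; b; c] -> x \in V.
  by rewrite !inE => /or3P[]/eqP->; rewrite -in_setD1 (subsetP SV).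
have eqvV x : x \in V -> same_dist p q v x.
  move=> xV; apply: (same_dist_extend ar).
  - by move=> s t /inV sV /inV tV; apply: eqV.
  - move=> s; rewrite !inE => /or3P[]/eqP->; apply: eqe;
    by [move: aS; rewrite inE | move: bS; rewrite inE | move: cS; rewrite inE].
  - by move=> s /inV; apply: eqV.
move=> s t sW tW; have [->|sv] := eqVneq s v.
  by have [->|tv] := eqVneq t v; [exact: same_dist_refl | apply: eqvV; rewrite !inE tv].
have sV : s \in V by rewrite !inE sv.
have [->|tv] := eqVneq t v; first exact/same_dist_sym/eqvV.
by apply: eqV; rewrite // !inE tv.
Qed.
End GlobalRigidity.

(** * Registration *)

Section Registration.
Variables (R : realType) (N : nat).
Local Notation T := 'I_N.
Implicit Types (X Y : T -> 'rV[R]_2) (E : euclid R).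

Definition cfg X (k : T) (b : bool) : R := X k 0 (if b then 1 else 0).

Lemma generic_cfg X : generic X -> generic_config (cfg X).
Proof.
move=> gX G /gX; have -> // : \matrix_(k < N, c < 2) X k 0 c =
  \matrix_(k < N, c < 2) cfg X k (c == 1).
apply/matrixP => k c; rewrite !mxE /cfg; congr (X k 0 _).
by case: c => [[|[|]]] // lt; apply: val_inj.
Qed.

Lemma sum_ord2 (F : 'I_2 -> R) : \sum_i F i = F 0 + F 1.
Proof. by rewrite !big_ord_recl big_ord0 addr0; congr (_ + F _); apply: val_inj. Qed.

Lemma ord2P (i : 'I_2) : i = 0 \/ i = 1.
Proof. by case: i => [[|[|]]] // lt; [left | right]; apply: val_inj. Qed.

Lemma dot_cfg X k l :
  dot (cfg X) (cfg X) k l = ((X k - X l) *m (X k - X l)^T) 0 0.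
Proof. by rewrite mxE sum_ord2 !mxE /dot. Qed.

Lemma eapp_sqdist E (x y : 'rV[R]_2) : is_euclid E ->
  (eapp E x - eapp E y) *m (eapp E x - eapp E y)^T = (x - y) *m (x - y)^T.
Proof.
move=> hE; rewrite /eapp opprD addrACA subrr addr0 -mulmxBl trmx_mul mulmxA.
by rewrite -(mulmxA (x - y)) (mulmx1C hE) mulmx1.
Qed.

Definition ecomp E E' := Euclid (eQ E *m eQ E') (et E *m eQ E' + et E').

Lemma eapp_ecomp E E' x : eapp (ecomp E E') x = eapp E' (eapp E x).
Proof. by rewrite /eapp /= mulmxDl mulmxA addrA. Qed.

Lemma is_euclid_ecomp E E' : is_euclid E -> is_euclid E' -> is_euclid (ecomp E E').
Proof.
rewrite /is_euclid /= => hE hE'.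
by rewrite trmx_mul mulmxA -(mulmxA _ _ (eQ E)) hE mulmx1.
Qed.

(** The matrices of edge vectors of a nondegenerate triangle have equal Gram matrices, so the linear
    map between them is orthogonal; common affine coordinates extend it to all points. *)
Lemma congruent_same_dist X Y a b c : area (cfg X) a b c != 0 ->
  (forall s t, same_dist (cfg X) (cfg Y) s t) ->
  exists E, is_euclid E /\ forall k, Y k = eapp E (X k).
Proof.
move=> ar eqd.
pose M (Z : T -> 'rV[R]_2) : 'M[R]_2 :=
  \matrix_(i, j) (if i == 0 then Z b 0 j - Z a 0 j else Z c 0 j - Z a 0 j).
have MX : M X \in unitmx.
  rewrite -row_free_unit; apply: inj_row_free => v vM.
  have vMj j : (X b 0 j - X a 0 j) * v 0 0 + (X c 0 j - X a 0 j) * v 0 1 = 0.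
    by have /rowP/(_ j) := vM; rewrite !mxE sum_ord2 !mxE /= => <-; ring.
  have [|v0 v1] := linear_system2 _ (vMj 0) (vMj 1).
    by apply: contra_neq ar => d0; rewrite -[RHS]d0 /area /cfg; ring.
  by apply/rowP => j; rewrite mxE; case: (ord2P j) => ->.
have gram : M Y *m (M Y)^T = M X *m (M X)^T.
  have ba := eqd b a; have ca := eqd c a; have bc := eqd b c.
  move: ba ca bc; rewrite /same_dist /dot /cfg => ba ca bc.
  apply/matrixP => i j; rewrite !mxE !sum_ord2 !mxE.
  by case: (ord2P i) => ->; case: (ord2P j) => -> /=; lra.
pose O := invmx (M X) *m M Y.
have MO : M X *m O = M Y by rewrite /O mulKVmx.
have OO : O *m O^T = 1%:M.
  rewrite /O trmx_mul mulmxA -(mulmxA _ (M Y)) gram trmx_inv.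
  by rewrite mulmxA mulVmx // mul1mx mulmxV // unitmx_tr.
exists (Euclid O (Y a - X a *m O)); split; first exact: mulmx1C.
move=> k.
have [s [t est]] := common_affine_coordinates ar (eqd b a) (eqd c a) (eqd b c)
  (eqd k a) (eqd k b) (eqd k c).
have vecE Z : (forall d, cfg Z k d = cfg Z a d + s * (cfg Z b d - cfg Z a d) +
     t * (cfg Z c d - cfg Z a d)) ->
   Z k = Z a + s *: row 0 (M Z) + t *: row 1 (M Z).
  move=> h; apply/rowP => j; rewrite !mxE /=.
  by case: (ord2P j) => ->; [have := h false | have := h true].
have eX := vecE X (fun d => (est d).1); have eY := vecE Y (fun d => (est d).2).
rewrite /eapp /= eX eY -MO !mulmxDl -!scalemxAl !row_mul.
by rewrite [RHS]addrC -!addrA addKr.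
Qed.

(** * Sufficiency: from patches to the body graph *)

Lemma patch_gt2 (M : nat) (P : 'I_M -> {set T}) (xloc : T -> 'I_M -> 'rV[R]_2) i :
  patch_affinely_spanning P xloc i -> (2 < #|P i|)%N.
Proof.
move=> [k0 [k1 [k2 [h0 h1 h2 rk]]]]; apply/card_gt2P; exists k0, k1, k2; split=> //.
(* Coinciding indices would put both rows into one line, whereas the rank is 2. *)
have small (u v : 'rV[R]_2) (w : 'rV[R]_2) : (u <= w)%MS -> (v <= w)%MS ->
    \rank (col_mx u v) != 2.
  move=> uw vw; rewrite neq_ltn; apply/orP; left; rewrite ltnS.
  apply: (@leq_trans (\rank w)); last exact: rank_leq_row.
  by apply: mxrankS; rewrite -addsmxE addsmx_sub uw.
split; apply/eqP => e; move/eqP: rk; apply/negP.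
- by apply: (small _ _ (xloc k2 i - xloc k0 i)); rewrite ?e ?subrr ?sub0mx // submx_refl.
- by apply: (small _ _ (xloc k1 i - xloc k0 i)); rewrite ?e submx_refl.
- by apply: (small _ _ (xloc k1 i - xloc k0 i)); rewrite ?e ?subrr ?sub0mx // submx_refl.
Qed.

(** A third node of the common patch closes each edge to a triangle; a path that leaves [A] and
    avoids [C] contains the edge required by [kcon]. *)
Lemma good_body_edge (M : nat) (P : 'I_M -> {set T}) :
  (forall i, 2 < #|P i|)%N -> k_connected (body_edge P) 3 ->
  good [set: T] (body_edge P).
Proof.
move=> P3 [_ conn]; split=> //.
- move=> s t; rewrite /body_edge eq_sym; congr (_ && _).
  by apply: eq_existsb => i; rewrite andbC.
- by move=> s; rewrite /body_edge eqxx.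
- move=> s t /andP[st /existsP[i /andP[sP tP]]].
  have : (0 < #|P i :\: [set s; t]|)%N.
    have := cardsID [set s; t] (P i).
    have := subset_leq_card (subsetIr (P i) [set s; t]).
    by have := P3 i; rewrite cards2 st; card_lia.
  case/card_gt0P => r; rewrite !inE negb_or => /andP[/andP[rs rt] rP].
  exists r; rewrite /body_edge ![_ == r]eq_sym rs rt /=.
  by apply/andP; split; apply/existsP; exists i; rewrite ?sP ?tP.
apply/kconP => A C _ dAC C3 /set0Pn[a aA] /set0Pn[b].
rewrite !inE negb_or andbT => /andP[bA bC].
have aC : a \notin C by rewrite (disjointFr dAC aA).
have /connectP[w] := conn C C3 a b aC bC.
elim: w a aA {aC} => [|c w IHw] a aA /=; first by move=> _ e; rewrite e aA in bA.
move=> /andP[/and3P[eac _ cC] pw] lw.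
have [cA|cA] := boolP (c \in A); first exact: IHw cA pw lw.
by exists a, c; rewrite inE.
Qed.

Lemma solution_same_dist (M : nat) (P : 'I_M -> {set T})
    (xloc : T -> 'I_M -> 'rV[R]_2) X Y (U V : 'I_M -> euclid R) s t :
  reg_solution P xloc X U -> reg_solution P xloc Y V ->
  body_edge P s t -> same_dist (cfg X) (cfg Y) s t.
Proof.
move=> [U1 U2] [V1 V2] /andP[_ /existsP[i /andP[sP tP]]].
rewrite /same_dist !dot_cfg (U2 _ _ sP) (U2 _ _ tP) (V2 _ _ sP) (V2 _ _ tP).
by rewrite !eapp_sqdist.
Qed.

(** Heron's formula: it carries noncollinearity over to configurations with equal distances. *)
Lemma sqr_area p (a b c : T) : (area p a b c ^+ 2 : R) *+ 4 =
  4 * dot p p b a * dot p p c a - (dot p p b a + dot p p c a - dot p p b c) ^+ 2.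
Proof. by rewrite /area /dot; ring. Qed.

Lemma connected_registrable (M : nat) (P : 'I_M -> {set T})
    (xloc : T -> 'I_M -> 'rV[R]_2) (xbar : T -> 'rV[R]_2) (Rbar : 'I_M -> euclid R) :
  (3 < N)%N -> reg_solution P xloc xbar Rbar -> (forall i, 2 < #|P i|)%N ->
  generic xbar -> k_connected (body_edge P) 3 -> uniquely_registrable P xloc.
Proof.
move=> N3 sol P3 /generic_cfg gx conn X U Y V solX solY.
have gB := good_body_edge P3 conn.
have NT : (3 < #|[set: T]|)%N by rewrite cardsT card_ord.
have all_dist Z Zt : reg_solution P xloc Z Zt ->
    forall s t, same_dist (cfg xbar) (cfg Z) s t.
  move=> solZ s t; apply: (global_rigidity gx gB NT) => // s' t'.
  exact: solution_same_dist sol solZ.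
have /card_gt2P[a [b [c [_ [ab bc ca]]]]] : (2 < #|[set: T]|)%N by rewrite ltnW.
have ar : area (cfg xbar) a b c != 0 by apply: generic_area => //; rewrite eq_sym.
have dX := all_dist _ _ solX; have dY := all_dist _ _ solY.
apply: (@congruent_same_dist _ _ a b c); last first.
  by move=> s t; rewrite /same_dist dX dY.
apply: contra_neq ar => ar0; apply/eqP; rewrite -(sqrf_eq0 (area _ _ _ _)).
have := sqr_area (cfg X) a b c; rewrite ar0 expr0n mul0rn.
rewrite [dot _ _ b a]dX [dot _ _ c a]dX [dot _ _ b c]dX -sqr_area => /esym/eqP.
by rewrite mulrn_eq0.
Qed.

(** * Necessity: reflection across a separating pair *)

Lemma reflection_exists (a b : 'rV[R]_2) : b 0 0 - a 0 0 != 0 ->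
  exists E, [/\ is_euclid E, eapp E a = a, eapp E b = b &
    forall x y : 'rV[R]_2,
      ((x - eapp E y) *m (x - eapp E y)^T) 0 0 = ((x - y) *m (x - y)^T) 0 0 ->
      ((b 0 0 - a 0 0) * (x 0 1 - a 0 1) - (b 0 1 - a 0 1) * (x 0 0 - a 0 0)) *
      ((b 0 0 - a 0 0) * (y 0 1 - a 0 1) - (b 0 1 - a 0 1) * (y 0 0 - a 0 0)) = 0].
Proof.
set dx := b 0 0 - a 0 0; set dy := b 0 1 - a 0 1 => dx0.
have n0 : dx ^+ 2 + dy ^+ 2 != 0.
  by rewrite gt_eqF // ltr_pwDl ?sqr_ge0 // exprn_even_gt0.
(* [c] and [s] are the cosine and sine of twice the angle of the line through [a] and [b]. *)
pose n := dx ^+ 2 + dy ^+ 2; pose c := (dx ^+ 2 - dy ^+ 2) / n.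
pose s := 2 * dx * dy / n.
pose Q : 'M[R]_2 := \matrix_(i, j) if i != j then s else if i == 0 then c else - c.
have cs : c ^+ 2 + s ^+ 2 = 1 by rewrite /c /s /n; field.
have QE (x : 'rV[R]_2) j : (x *m Q) 0 j =
    if j == 0 then x 0 0 * c + x 0 1 * s else x 0 0 * s - x 0 1 * c.
  rewrite !mxE sum_ord2 !mxE /=; case: (ord2P j) => -> /=; by rewrite ?mulrN.
pose E := Euclid Q (a - a *m Q).
have EE x : eapp E x = a + (x - a) *m Q.
  by rewrite /eapp /= mulmxBl addrCA.
exists E; split.
- rewrite /is_euclid /=; apply/matrixP => i j; rewrite !mxE sum_ord2 !mxE.
  by case: (ord2P i) => ->; case: (ord2P j) => -> /=; rewrite ?mulr1n ?mulr0n -?cs; ring.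
- by rewrite EE subrr mul0mx addr0.
- rewrite EE; apply/rowP => j; rewrite mxE QE !mxE -/dx -/dy /c /s /n.
  have db0 : b 0 0 = a 0 0 + dx by rewrite /dx; ring.
  have db1 : b 0 1 = a 0 1 + dy by rewrite /dy; ring.
  by case: (ord2P j) => -> /=; rewrite ?db0 ?db1; field.
have sq (z : 'rV[R]_2) : (z *m z^T) 0 0 = z 0 0 ^+ 2 + z 0 1 ^+ 2.
  by rewrite mxE sum_ord2 !mxE !expr2.
have Ej y j : eapp E y 0 j = a 0 j + if j == 0 then (y 0 0 - a 0 0) * c + (y 0 1 - a 0 1) * s
    else (y 0 0 - a 0 0) * s - (y 0 1 - a 0 1) * c.
  by rewrite EE mxE QE !mxE.
have subE (x z : 'rV[R]_2) j : (x - z) 0 j = x 0 j - z 0 j by rewrite !mxE.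
move=> x y; rewrite !sq !subE !Ej /= => h.
(* Reflecting [y] changes its squared distance to [x] by four times the product of the signed
   distances of both points to the line. *)
transitivity (n / 4 * ((x 0 0 - (a 0 0 + ((y 0 0 - a 0 0) * c + (y 0 1 - a 0 1) * s))) ^+ 2 +
   (x 0 1 - (a 0 1 + ((y 0 0 - a 0 0) * s - (y 0 1 - a 0 1) * c))) ^+ 2 -
   ((x 0 0 - y 0 0) ^+ 2 + (x 0 1 - y 0 1) ^+ 2))); last by rewrite h subrr mulr0.
by rewrite /c /s /n; field.
Qed.

Lemma connect_leaves (e : rel T) (A : {set T}) a b : connect e a b ->
  a \in A -> b \notin A -> exists x y, [/\ x \in A, y \notin A & e x y].
Proof.
move=> /connectP[w]; elim: w a => [|c w IHw] a /=; first by move=> _ -> ->.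
move=> /andP[eac pw] lw aA bA; have [cA|cA] := boolP (c \in A); first exact: IHw cA bA.
by exists a, c.
Qed.

Lemma registrable_connected (M : nat) (P : 'I_M -> {set T})
    (xloc : T -> 'I_M -> 'rV[R]_2) (xbar : T -> 'rV[R]_2) (Rbar : 'I_M -> euclid R) :
  (3 < N)%N -> reg_solution P xloc xbar Rbar -> generic xbar ->
  uniquely_registrable P xloc -> k_connected (body_edge P) 3.
Proof.
move=> N3 sol /generic_cfg gx uniq; split=> // S S3 u v uS vS.
apply: contraT => nuv.
have uv : u != v by apply: contraNneq nuv => ->; rewrite connect0.
(* As [N > 3], the separator can be enlarged to exactly two vertices while avoiding [u] and [v]. *)
have [s1 [s2 [s12 SS u1 v1]]] : exists s1 s2, [/\ s1 != s2, S \subset [set s1; s2],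
    u \notin [set s1; s2] & v \notin [set s1; s2]].
  pose D := ~: (u |: (v |: S)).
  have inD x : x \in D -> [/\ x != u, x != v & x \notin S].
    by rewrite !inE !negb_or => /and3P[].
  have cD : (#|D| + #|S| >= 2)%N.
    have := cardsC (u |: (v |: S)); rewrite card_ord -/D.
    have : (#|u |: (v |: S)| <= 2 + #|S|)%N.
      rewrite cardsU1 cardsU1; case: (u \notin _); case: (v \notin _); card_lia.
    by move: N3; card_lia.
  have : (#|S| == 0)%N || (#|S| == 1)%N || (#|S| == 2)%N by move: S3; card_lia.
  case/orP=> [/orP[]|].
  - rewrite cards_eq0 => /eqP S0; move: cD; rewrite S0 cards0 addn0.
    case/card_gt1P=> x [y [/inD[xu xv _] /inD[yu yv _] xy]]; exists x, y; split=> //.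
    + exact: sub0set.
    + by rewrite !inE negb_or ![u == _]eq_sym xu.
    + by rewrite !inE negb_or ![v == _]eq_sym xv.
  - case/cards1P=> x Sx; move: cD; rewrite Sx cards1 addn1 ltnS.
    case/card_gt0P=> y /inD[yu yv]; rewrite Sx inE => yx.
    exists x, y; split; first by rewrite eq_sym.
    + by rewrite subsetUl.
    + by move: uS; rewrite Sx !inE negb_or => ->; rewrite eq_sym.
    + by move: vS; rewrite Sx !inE negb_or => ->; rewrite eq_sym.
  - case/cards2P=> x [y [xy Sxy]]; exists x, y; split=> //; by rewrite -?Sxy.
set S' := [set s1; s2] in SS u1 v1.
pose r := [rel a b | [&& body_edge P a b, a \notin S' & b \notin S']].
pose A := [set k | connect r u k].
have vA : v \notin A.
  rewrite inE; apply: contra nuv; apply: connect_sub => a b /and3P[ab aS bS].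
  by apply: connect1; rewrite /= ab !(contra (subsetP SS _)).
have AS k : k \in A -> k \notin S'.
  rewrite inE => uk; apply/negP => kS.
  have [||x [y [_ yS /and3P[_ _ yS']]]] := @connect_leaves r (~: S') u k uk.
  - by rewrite inE.
  - by rewrite inE negbK.
  by move: yS; rewrite inE yS'.
(* Nodes of a patch are pairwise adjacent, so a patch meeting the component [A] stays within [A] and
   the separating pair. *)
have side i k l : k \in P i -> l \in P i -> k \in A -> l \in A :|: S'.
  move=> kP lP kA; rewrite in_setU; have [lS|lS] := boolP (l \in S'); first exact: orbT.
  rewrite orbF inE; have [<-|kl] := eqVneq k l; first by move: kA; rewrite inE.
  move: (kA); rewrite inE => uk; apply: (connect_trans uk); apply: connect1.
  rewrite /= lS (AS _ kA) !andbT /body_edge kl; apply/existsP; exists i; by rewrite kP.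
have dx0 : xbar s2 0 0 - xbar s1 0 0 != 0.
  by apply: (generic_coord_neq false gx); rewrite eq_sym.
have [E [hE E1 E2 Edist]] := reflection_exists dx0.
(* Everything outside [A] and the pair is reflected; [E] fixes the pair, so patches on both sides
   agree there. *)
pose Y k := if k \in A :|: S' then xbar k else eapp E (xbar k).
pose U i := if P i \subset A :|: S' then Rbar i else ecomp (Rbar i) E.
have [Rb1 Rb2] := sol.
have solY : reg_solution P xloc Y U.
  split=> [i|i k kP].
    by rewrite /U; case: ifP => _ //; apply: is_euclid_ecomp.
  rewrite /Y /U; have [PA|/subsetPn[l lP lA]] := boolP (P i \subset A :|: S').
    by rewrite (subsetP PA _ kP); apply: Rb2.
  rewrite eapp_ecomp -(Rb2 i k kP); case: ifP => // /setUP[kA|].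
    by case/negP: lA; apply: side kP lP kA.
  by rewrite /S' !inE => /orP[]/eqP->; rewrite ?E1 ?E2.
have [Q [hQ YQ]] := uniq _ _ _ _ sol solY.
have uA : u \in A by rewrite inE connect0.
have Yu : Y u = xbar u by rewrite /Y in_setU uA.
have Yv : Y v = eapp E (xbar v).
  by rewrite /Y in_setU (negPf vA) (negPf v1).
(* A congruence would preserve the distance between [u] and [v], which puts one of them on the
   mirror line, against genericity. *)
have /Edist : ((xbar u - eapp E (xbar v)) *m (xbar u - eapp E (xbar v))^T) 0 0 =
    ((xbar u - xbar v) *m (xbar u - xbar v)^T) 0 0.
  by rewrite -Yv -{1 2}Yu !YQ eapp_sqdist.
have ns x : x \notin S' -> s2 != x /\ s1 != x.
  by rewrite !inE negb_or => /andP[]; rewrite ![x == _]eq_sym.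
have [u2 u1'] := ns _ u1; have [v2 v1'] := ns _ v1.
move/eqP; rewrite mulf_eq0 => /orP[/eqP h|/eqP h].
  by have := generic_area gx s12 u2 u1'; rewrite /area /cfg h eqxx.
by have := generic_area gx s12 v2 v1'; rewrite /area /cfg h eqxx.
Qed.
End Registration.

Theorem theorem5 (R : realType) (N M : nat) (P : 'I_M -> {set 'I_N})
    (xloc : 'I_N -> 'I_M -> 'rV[R]_2) (xbar : 'I_N -> 'rV[R]_2)
    (Rbar : 'I_M -> euclid R)
    (hN : (3 < N)%N)
    (hRbar : forall i, is_euclid (Rbar i))
    (hgt : forall i k, k \in P i -> xbar k = eapp (Rbar i) (xloc k i))
    (A1 : forall i, patch_affinely_spanning P xloc i)
    (A2 : generic xbar) :
  uniquely_registrable P xloc <-> k_connected (body_edge P) 3.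
Proof.
have sol : reg_solution P xloc xbar Rbar by [].
split; first exact: registrable_connected sol A2.
exact: (connected_registrable hN sol (fun i => patch_gt2 (A1 i)) A2).
Qed.
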